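(* Consider the problem (SCO): given access to a stochastic gradient oracle for a differentiable, convex and $L$-Lipschitz function $f\colon\mathbb{R}^d\to\mathbb{R}$ such that there exists $x^\star\in\operatorname{argmin}_{x\in\mathbb{R}^d}f(x)$ with $\|x^\star\|\le R$, output an $\epsilon$-optimal point of $f$. Any algorithm which solves this problem with probability at least $2/3$ using a $\sigma_E$-ESGO makes at least $$\tilde\Omega\left(\frac{R^2\sigma_E^2}{\epsilon^2}+\min\left\{\frac{R^2L^2}{\epsilon^2},\,d\right\}\right)$$ queries.
   Context: $\|\cdot\|$ is the Euclidean norm; Lipschitzness is with respect to it. A point $x$ is $\epsilon$-optimal if $f(x)\le \inf_y f(y)+\epsilon$. A stochastic gradient oracle (SGO) for $f$ is an oracle $\mathcal{O}$ which, when queried at $x\in\mathbb{R}^d$, outputs a random vector $\mathcal{O}(x)\in\mathbb{R}^d$ with $\mathbb{E}\,\mathcal{O}(x)=\nabla f(x)$; the randomness of each call is independent of previous calls. A $\sigma_E$-sub-exponential SGO ($\sigma_E$-ESGO) is an SGO $\mathcal{O}_E$ such that for all $x,u\in\mathbb{R}^d$ with $\|u\|=1$ and all $t\ge0$, $\mathbb{P}\left[|\langle \mathcal{O}_E(x)-\nabla f(x),u\rangle|\ge t\right]\le 2\exp(-t\sqrt d/\sigma_E)$. $\tilde\Omega(\cdot)$ omits polylogarithmic factors.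
   Formalization: The bound is stated for $\epsilon\le\kappa LR$ with any fixed $\kappa<1$, the hidden constants depending only on $\kappa$; for $\epsilon\ge LR$ the claim fails, since the point $0$ is $\epsilon$-optimal with no queries. *)

(* Defs.v *)
From HB Require Import structures.
From mathcomp Require Import all_boot all_order all_algebra.
From mathcomp Require Import all_classical all_reals all_analysis.
From mathcomp Require Import convex.

Set Implicit Arguments.
Unset Strict Implicit.
Unset Printing Implicit Defensive.

Import Order.TTheory GRing.Theory Num.Theory.
Import numFieldNormedType.Exports.

Local Open Scope classical_set_scope.
Local Open Scope ring_scope.

(** * Euclidean structure on [R^d]

    The library norm on ['rV[R]_d] is the sup norm, hence [enorm] below.
    The topology, and so [differentiable], does not depend on this choice. *)

Definition dotp (R : realType) (d : nat) (x y : 'rV[R]_d) : R :=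
  \sum_(i < d) x 0 i * y 0 i.

Definition enorm (R : realType) (d : nat) (x : 'rV[R]_d) : R :=
  Num.sqrt (dotp x x).

Definition grad (R : realType) (d : nat) (f : 'rV[R]_d -> R) (x : 'rV[R]_d) :
    'rV[R]_d :=
  \row_(i < d) 'D_(delta_mx 0 i) f x.

(** The Borel sigma-algebra of [R^d], generated by the coordinates (the same
    construction as the library's one on [n.-tuple T]). *)
Definition measure_rV_display : measure_display.
Proof. exact. Qed.

Section measurable_rV.
Variables (R : realType) (d : nat).

Let coord (i : 'I_d) (x : 'rV[R]_d) : measurableTypeR R := x 0 i.

Let rV_set0 : g_sigma_preimage coord set0.
Proof. exact: sigma_algebra0. Qed.

Let rV_setC A : g_sigma_preimage coord A -> g_sigma_preimage coord (~` A).
Proof. exact: sigma_algebraC. Qed.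

Let rV_bigcup (F : (set 'rV[R]_d)^nat) :
  (forall i, g_sigma_preimage coord (F i)) ->
  g_sigma_preimage coord (\bigcup_i (F i)).
Proof. exact: sigma_algebra_bigcup. Qed.

HB.instance Definition _ := @isMeasurable.Build measure_rV_display
  'rV[R]_d (g_sigma_preimage coord) rV_set0 rV_setC rV_bigcup.

End measurable_rV.

(** * The optimization problem *)

Definition lipschitz_with (R : realType) (d : nat) (L : R)
    (f : 'rV[R]_d -> R) : Prop :=
  forall x y, `|f x - f y| <= L * enorm (x - y).

Definition sco_instance (R : realType) (d : nat) (rad L : R)
    (f : 'rV[R]_d -> R) : Prop :=
  [/\ forall x, differentiable f x,
      convex_function [set: convex_lmodType 'rV[R]_d] (f : _ -> R^o),
      lipschitz_with L f &
      exists xstar, (forall y, f xstar <= f y) /\ enorm xstar <= rad].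

Definition eps_optimal (R : realType) (d : nat) (eps : R)
    (f : 'rV[R]_d -> R) (x : 'rV[R]_d) : Prop :=
  f x <= inf (range f) + eps.

(** * Stochastic gradient oracles

    An oracle draws a fresh noise [z] with law [zeta] at each call and answers
    [O x z] to the query [x]. *)

Definition is_sgo (R : realType) (d : nat) (f : 'rV[R]_d -> R)
    (dZ : measure_display) (Z : measurableType dZ) (zeta : probability Z R)
    (O : 'rV[R]_d -> Z -> 'rV[R]_d) : Prop :=
  measurable_fun [set: 'rV[R]_d * Z] (fun w => O w.1 w.2) /\
  forall (x : 'rV[R]_d) (i : 'I_d),
    zeta.-integrable [set: Z] (fun z => (O x z 0%R i)%:E) /\
    ('E_zeta[fun z => O x z 0%R i])%E = (grad f x 0 i)%:E.

Definition is_esgo (R : realType) (d : nat) (sigma : R) (f : 'rV[R]_d -> R)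
    (dZ : measure_display) (Z : measurableType dZ) (zeta : probability Z R)
    (O : 'rV[R]_d -> Z -> 'rV[R]_d) : Prop :=
  is_sgo f zeta O /\
  forall (x u : 'rV[R]_d) (t : R), enorm u = 1 -> 0 <= t ->
    (zeta [set z | (t <= `|dotp (O x z - grad f x) u|)%R]
      <= (2 * expR (- (t * Num.sqrt d%:R / sigma)))%:E)%E.

(** * Algorithms

    [S] is the space of the internal randomness. The next query and the output
    are functions of the seed and of the answers received so far, in
    chronological order; the past queries can be recomputed from these. *)

Record algorithm (R : realType) (d : nat) (dS : measure_display)
    (S : measurableType dS) := Algorithm {
  query : S -> seq 'rV[R]_d -> 'rV[R]_d ;
  output : S -> seq 'rV[R]_d -> 'rV[R]_d ;
  measurable_query : forall t : nat,
    measurable_fun [set: S * t.-tuple 'rV[R]_d] (fun w => query w.1 w.2) ;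
  measurable_output : forall t : nat,
    measurable_fun [set: S * t.-tuple 'rV[R]_d] (fun w => output w.1 w.2)
}.

Definition answers (R : realType) (d : nat) (dS : measure_display)
    (S : measurableType dS) (A : algorithm R d S) (Z : Type)
    (O : 'rV[R]_d -> Z -> 'rV[R]_d) (s : S) (zs : seq Z) : seq 'rV[R]_d :=
  foldl (fun h z => rcons h (O (query A s h) z)) [::] zs.

Definition run (R : realType) (d : nat) (dS : measure_display)
    (S : measurableType dS) (A : algorithm R d S) (Z : Type)
    (O : 'rV[R]_d -> Z -> 'rV[R]_d) (s : S) (zs : seq Z) : 'rV[R]_d :=
  output A s (answers A O s zs).

Section iid.
Context (R : realType) (dZ : measure_display) (Z : measurableType dZ).

Definition tcons (n : nat) (w : Z * n.-tuple Z) : n.+1.-tuple Z :=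
  [tuple of w.1 :: w.2].

Let measurable_tcons (n : nat) : measurable_fun setT (@tcons n).
Proof. exact: measurable_cons. Qed.

HB.instance Definition _ (n : nat) :=
  isMeasurableFun.Build _ _ _ _ (@tcons n) (@measurable_tcons n).

(** The law of [n] independent draws from [zeta]. *)
Fixpoint iid (zeta : probability Z R) (n : nat) : probability (n.-tuple Z) R :=
  match n return probability (n.-tuple Z) R with
  | 0%N => \d_([tuple] : 0.-tuple Z)
  | m.+1 => distribution (zeta \x iid zeta m)%E (@tcons m)
  end.

End iid.

(** [A], with seed distributed as [P] and making [N] queries, outputs an
    [eps]-optimal point with probability at least [2/3], for every instance and
    every [sigma]-ESGO of it. *)
Definition solves (R : realType) (d : nat) (rad L sigma eps : R)
    (dS : measure_display) (S : measurableType dS) (P : probability S R)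
    (A : algorithm R d S) (N : nat) : Prop :=
  forall f : 'rV[R]_d -> R, sco_instance rad L f ->
  forall (dZ : measure_display) (Z : measurableType dZ)
    (zeta : probability Z R) (O : 'rV[R]_d -> Z -> 'rV[R]_d),
    is_esgo sigma f zeta O ->
    ((2 / 3)%:E <=
      (P \x iid zeta N) [set w : S * N.-tuple Z |
                          eps_optimal eps f (run A O w.1 w.2)])%E.

(* Main.v *)
(** Two families of instances give the two terms of the bound.

    Dimension term: take a smoothed maximum of the [m] affine functions
    [r - s_i x_i], with [m] of order [min(R^2 L^2 / eps^2, d)] and [s] a sign
    vector, and answer with exact gradients. An [eps]-optimal point has the
    signs of [s]. Away from the kinks an answer is one of [2m + 1] vectors, so
    [N] answers distinguish at most [(2m + 1)^N] of the [2^m] sign vectors. The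
    smoothing is made so narrow, and the functions are shifted at random by so
    many different amounts, that with high probability no query reachable by
    the algorithm comes close to a kink.

    Noise term: take [f_s(x)] proportional to the sum of the
    [|x_j - s_j w|], smoothed. Since [s_j] is a sign, each partial derivative is
    affine in [s_j], so that an unbiased answer is computed from [d] independent
    bits of mean [rho s_j], with [rho] of order [eps / (R sigma)], whose law
    does not depend on the query: the algorithm only sees [N] independent
    samples. An [eps]-optimal point is correlated with [s], which requires
    [N rho^2] to be bounded below, by Assouad's method in large dimension and by
    comparing [s] with [-s] in small dimension. *)

From HB Require Import structures.
Require Import Defs.
From mathcomp Require Import all_boot all_order all_algebra.
From mathcomp Require Import all_classical all_reals all_analysis.
From mathcomp Require Import measurable_realfun zify ring lra.

Set Implicit Arguments.
Unset Strict Implicit.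
Unset Printing Implicit Defensive.

Import Order.TTheory GRing.Theory Num.Theory.
Import numFieldNormedType.Exports.

Local Open Scope classical_set_scope.
Local Open Scope ring_scope.

(** * Finitely supported noise and runs of an algorithm *)

Lemma measurable_coord (R : realType) (d : nat) (i : 'I_d) :
  measurable_fun [set: 'rV[R]_d] (fun x : 'rV[R]_d => x 0 i).
Proof.
move=> _ Y mY; rewrite setTI; apply: sub_sigma_algebra => /=.
rewrite -bigcup_seq/=; exists i => /=; first by rewrite mem_index_enum.
by exists Y => //; rewrite setTI.
Qed.

Lemma measurable_fun_rVP (R : realType) (d : nat) d1 (T : measurableType d1)
    (f : T -> 'rV[R]_d) :
  (forall i, measurable_fun [set: T] (fun t => f t 0 i)) ->
  measurable_fun [set: T] f.
Proof.
move=> mf; pose coord (i : 'I_d) (x : 'rV[R]_d) : measurableTypeR R := x 0 i.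
have : g_sigma_preimage (fun i : 'I_d => coord i \o f) `<=` measurable.
  apply: smallest_sub; first exact: sigma_algebra_measurable.
  case: d => [|n] in f mf coord *; first by rewrite big_ord0.
  rewrite -bigcup_mkord_ord; apply: bigcup_sub => i Ii.
  by move=> A [B mB <-]; exact: mf.
rewrite (g_sigma_preimage_comp coord f) => prefS _ A mA.
by apply: prefS; exists A.
Qed.

(** * Measures with finitely many atoms *)

Section finite_support.
Context (R : realType) d (T : measurableType d) (I : finType).
Variables (w : I -> R) (pt : I -> T).

Definition finitely_supported (mu : set T -> \bar R) :=
  forall A, measurable A -> mu A = (\sum_i (w i)%:E * \d_(pt i) A)%E.

Hypothesis w0 : forall i, 0 <= w i.

(** [msum] adds up a sequence of measures, so the atoms are numbered through [enum_val]; numbers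
    from [#|I|] on get the zero measure. *)
Definition atom_measure (k : nat) : {measure set T -> \bar R} :=
  if insub k is Some j then
    mscale (NngNum (w0 (enum_val (j : 'I_#|I|)))) (\d_(pt (enum_val j)))
  else mzero.

Lemma msum_atom_measure A :
  msum atom_measure #|I| A = (\sum_i (w i)%:E * \d_(pt i) A)%E.
Proof.
rewrite [RHS]big_enum_val /msum; apply: eq_bigr => i _.
by rewrite /atom_measure; case: insubP => [u _ /val_inj ->|]; rewrite ?ltn_ord.
Qed.

Lemma ge0_integral_finitely_supported (mu : {measure set T -> \bar R})
    (f : T -> \bar R) :
  finitely_supported mu -> (forall x, (0 <= f x)%E) -> measurable_fun setT f ->
  (\int[mu]_x f x = \sum_i (w i)%:E * f (pt i))%E.
Proof.
move=> muE f0 mf.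
rewrite (eq_measure_integral (msum atom_measure #|I|)); last first.
  by move=> A mA _; rewrite muE// -msum_atom_measure.
rewrite ge0_integral_measure_sum// [RHS]big_enum_val; apply: eq_bigr => i _.
rewrite /atom_measure; case: insubP => [u _ /val_inj ->|]; rewrite ?ltn_ord//.
by rewrite ge0_integral_mscale// integral_dirac// diracT mul1e.
Qed.

Lemma integral_finitely_supported (mu : {measure set T -> \bar R})
    (f : T -> R) :
  finitely_supported mu -> measurable_fun setT f ->
  (\int[mu]_x (f x)%:E = (\sum_i w i * f (pt i))%:E)%E.
Proof.
move=> muE mf; rewrite integralE.
have mf' : measurable_fun setT (EFin \o f) by exact/measurable_EFinP.
rewrite !ge0_integral_finitely_supported//; last 2 first.
- exact: measurable_funeneg.
- exact: measurable_funepos.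
under eq_bigr do rewrite funeposE /= -EFin_max -EFinM.
under [X in (_ - X)%E]eq_bigr do rewrite funenegE /= -EFin_max -EFinM.
rewrite !sumEFin -EFinB -sumrB; congr EFin; apply: eq_bigr => i _.
by rewrite -mulrBr; congr (_ * _); rewrite /Num.max; do 2 case: ifPn; lra.
Qed.

Lemma integrable_finitely_supported (mu : {measure set T -> \bar R})
    (f : T -> R) :
  finitely_supported mu -> measurable_fun setT f ->
  mu.-integrable setT (EFin \o f).
Proof.
move=> muE mf; have mf' : measurable_fun setT (EFin \o f) by
  exact/measurable_EFinP.
apply/integrableP; split => //; rewrite ge0_integral_finitely_supported//.
  under eq_bigr do rewrite /= -EFinM.
  by rewrite sumEFin ltry.
exact: measurableT_comp.
Qed.

(* The proof of normalization is an argument so that [fprob] is canonically a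
   probability. *)
Definition fprob (_ : \sum_i w i = 1) : set T -> \bar R :=
  msum atom_measure #|I|.

HB.instance Definition _ w1 := Measure.on (fprob w1).

Let fprob_setT w1 : fprob w1 setT = 1%E.
Proof.
rewrite /fprob msum_atom_measure; under eq_bigr do rewrite diracT mule1.
by rewrite sumEFin w1.
Qed.

HB.instance Definition _ w1 :=
  @Measure_isProbability.Build _ _ R (fprob w1) (fprob_setT w1).

Lemma finitely_supported_fprob w1 : finitely_supported (fprob w1).
Proof. by move=> A _; rewrite /fprob msum_atom_measure. Qed.

Lemma fprobE w1 A : fprob w1 A = (\sum_i w i * (pt i \in A)%:R)%:E.
Proof.
rewrite /fprob msum_atom_measure -sumEFin.
by apply: eq_bigr => i _; rewrite diracE -EFinM.
Qed.

End finite_support.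

Lemma big_tuple_cons (V : nmodType) (I : finType) (n : nat)
    (F : n.+1.-tuple I -> V) :
  \sum_t F t = \sum_x \sum_(t : n.-tuple I) F [tuple of x :: t].
Proof.
rewrite pair_big/= (reindex (fun p : I * n.-tuple I => [tuple of p.1 ::
  p.2]))//.
exists (fun t => (thead t, [tuple of behead t])) => [[x t] _|t _] /=.
  by congr pair; apply/val_inj.
by rewrite [RHS]tuple_eta.
Qed.

(** Integrating the first draw over its atoms leaves sections that the induction hypothesis weighs.
    Probabilities over noise become finite sums of product weights. *)
Lemma finitely_supported_iid (R : realType) d (Z : measurableType d)
    (zeta : probability Z R) (I : finType) (w : I -> R) (pt : I -> Z) (n : nat)
      :
  (forall i, 0 <= w i) -> finitely_supported w pt zeta ->
  finitely_supported (fun t : n.-tuple I => \prod_(i <- t) w i)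
    (fun t => [tuple of map pt t]) (iid zeta n).
Proof.
move=> w0 zE; elim: n => [|n IHn] A mA.
  rewrite /= (big_pred1 [tuple]) => [|t]; last by apply/esym/eqP; rewrite
    [t]tuple0.
  by rewrite big_nil mul1e [X in (\d_X _)%E]tuple0 [X in _ = (\d_X _)%E]tuple0.
rewrite big_tuple_cons /= /distribution /pushforward /product_measure1.
set B := _ @^-1` A; have mB : measurable B.
  by rewrite -[B]setTI; apply: (measurable_funP (@tcons _ _ n)).
rewrite (ge0_integral_finitely_supported w0 zE)//; last exact:
  measurable_fun_xsection.
apply: eq_bigr => i _; rewrite /= IHn; last exact: measurable_xsection.
rewrite ge0_sume_distrr; last first.
  by move=> t _; rewrite mule_ge0// lee_fin prodr_ge0.
apply: eq_bigr => t _; rewrite big_cons EFinM muleA; congr (_ * _)%E.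
rewrite !diracE; congr ((_ : bool)%:R%:E).
have tE : [tuple of map pt [tuple of i :: t]] = tcons (pt i, [tuple of map pt
  t]).
  exact/val_inj.
by rewrite tE mem_xsection; apply/idP/idP; rewrite !inE.
Qed.

Lemma product_measure1_finitely_supported (R : realType) d d' (S :
  measurableType d) (Z : measurableType d')
    (P : probability S R) (Q : probability Z R) (I : finType) (w : I -> R)
    (pt : I -> Z) (E : set (S * Z)) :
  (forall i, 0 <= w i) -> finitely_supported w pt Q -> measurable E ->
  ((P \x Q) E = \int[P]_s (\sum_i w i * \1_E (s, pt i))%:E)%E.
Proof.
move=> w0 QE mE; rewrite /product_measure1; apply: eq_integral => s _ /=.
rewrite QE; last exact: measurable_xsection.
rewrite -sumEFin; apply: eq_bigr => i _; rewrite EFinM; congr (_ * _)%E.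
by rewrite diracE indicE mem_xsection.
Qed.

(** * Transcripts of an algorithm and their measurability *)

Section algorithms.
Context (R : realType) (d : nat) (dS dZ : measure_display)
  (S : measurableType dS) (Z : measurableType dZ).
Variables (A : algorithm R d S) (O : 'rV[R]_d -> Z -> 'rV[R]_d).

Lemma answers_rcons s zs z :
  answers A O s (rcons zs z) =
  rcons (answers A O s zs) (O (query A s (answers A O s zs)) z).
Proof. by rewrite /answers foldl_rcons. Qed.

Lemma size_answers s zs : size (answers A O s zs) = size zs.
Proof.
by elim/last_ind: zs => // zs z IH; rewrite answers_rcons !size_rcons IH.
Qed.

Lemma take_answers s zs zs' :
  take (size zs) (answers A O s (zs ++ zs')) = answers A O s zs.
Proof.
elim/last_ind: zs' => [|zs' z IH].
  by rewrite cats0 take_oversize// size_answers.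
rewrite -rcons_cat answers_rcons -cats1 takel_cat//.
by rewrite size_answers size_cat leq_addr.
Qed.

Lemma nth_answers s zs z0 j : (j < size zs)%N ->
  nth 0 (answers A O s zs) j =
  O (query A s (mkseq (nth 0 (answers A O s zs)) j)) (nth z0 zs j).
Proof.
move=> jz; have zsE : zs = rcons (take j zs) (nth z0 zs j) ++ drop j.+1 zs.
  by rewrite cat_rcons -drop_nth// cat_take_drop.
have sj : size (take j zs) = j by rewrite size_takel// ltnW.
have -> : mkseq (nth 0 (answers A O s zs)) j = answers A O s (take j zs).
  rewrite -(take_answers s (take j zs) (drop j zs)) cat_take_drop sj.
  apply: (@eq_from_nth _ 0).
    by rewrite size_mkseq size_takel// size_answers ltnW.
  by move=> i; rewrite size_mkseq => ij; rewrite nth_mkseq// nth_take.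
have := take_answers s (rcons (take j zs) (nth z0 zs j)) (drop j.+1 zs).
rewrite size_rcons sj -zsE => tE.
by rewrite -[LHS](nth_take 0 (ltnSn j)) tE answers_rcons nth_rcons size_answers
  sj ltnn eqxx.
Qed.

Hypothesis mO : measurable_fun [set: 'rV[R]_d * Z] (fun w => O w.1 w.2).

(** Strong induction through [nth_answers]: the earlier answers are packed into a tuple, since the
    measurability of [query] is stated on tuples of fixed length. *)
Lemma measurable_nth_answers n j : (j < n)%N ->
  measurable_fun [set: S * n.-tuple Z]
    (fun w => nth 0 (answers A O w.1 w.2) j).
Proof.
elim/ltn_ind: j => j IH jn.
pose h (w : S * n.-tuple Z) : j.-tuple 'rV[R]_d :=
  [tuple nth 0 (answers A O w.1 w.2) k | k < j].
have mh : measurable_fun setT h.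
  apply/measurable_fun_tnthP => k /=.
  apply: (eq_measurable_fun (fun w : S * n.-tuple Z => nth 0 (answers A O w.1
    w.2) k)).
    by move=> w _; rewrite /= /h tnth_mktuple.
  by apply: IH; rewrite ?(ltn_trans _ jn).
apply: (eq_measurable_fun (fun w : S * n.-tuple Z =>
   O (query A w.1 (h w)) (tnth w.2 (Ordinal jn)))).
  move=> w _; rewrite (nth_answers _ (tnth w.2 (Ordinal jn))) ?size_tuple//.
  congr (O (query _ _ _) _); last exact: tnth_nth.
  by rewrite /h /mkseq -val_enum_ord -map_comp.
have mq : measurable_fun [set: S * n.-tuple Z] (fun w => query A w.1 (h w)).
  exact: (measurableT_comp (measurable_query A (t := j)) (measurable_fun_pair
    measurable_fst mh)).
have mt : measurable_fun [set: S * n.-tuple Z] (fun w => tnth w.2 (Ordinal jn)).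
  exact: (measurableT_comp (@measurable_tnth _ _ _ (Ordinal jn))
    measurable_snd).
exact: (measurableT_comp mO (measurable_fun_pair mq mt)).
Qed.

Lemma measurable_run n :
  measurable_fun [set: S * n.-tuple Z] (fun w => run A O w.1 w.2).
Proof.
pose h (w : S * n.-tuple Z) : n.-tuple 'rV[R]_d :=
  [tuple nth 0 (answers A O w.1 w.2) k | k < n].
have mh : measurable_fun setT h.
  apply/measurable_fun_tnthP => k /=.
  apply: (eq_measurable_fun (fun w : S * n.-tuple Z => nth 0 (answers A O w.1
    w.2) k)).
    by move=> w _; rewrite /= /h tnth_mktuple.
  exact: measurable_nth_answers.
apply: (eq_measurable_fun (fun w : S * n.-tuple Z => output A w.1 (h w))).
  move=> w _; rewrite /run; congr output.
  apply: (@eq_from_nth _ 0) => [|i]; rewrite size_tuple ?size_answers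
    ?size_tuple//.
  by move=> i_n; rewrite /h (nth_map (Ordinal i_n)) ?size_enum_ord//
    nth_enum_ord.
exact: (measurableT_comp (measurable_output A (t := n)) (measurable_fun_pair
  measurable_fst mh)).
Qed.

End algorithms.

(* By Fubini it suffices to bound, for each fixed seed, the success probability
   averaged over a finite family of instances. *)
Lemma solves_average (R : realType) (d : nat) (rad L sigma eps : R)
    (dS : measure_display) (S : measurableType dS) (P : probability S R)
    (A : algorithm R d S) (N : nat) (J I : finType) dZ (Z : measurableType dZ)
    (f : J -> 'rV[R]_d -> R) (zeta : J -> probability Z R)
    (O : J -> 'rV[R]_d -> Z -> 'rV[R]_d) (w : J -> I -> R) (pt : I -> Z) (C :
      R) :
  solves rad L sigma eps P A N ->
  (forall j, sco_instance rad L (f j)) ->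
  (forall j, measurable_fun setT (f j)) ->
  (forall j, is_esgo sigma (f j) (zeta j) (O j)) ->
  (forall j i, 0 <= w j i) ->
  (forall j, finitely_supported (w j) pt (zeta j)) ->
  (forall s, \sum_j \sum_(t : N.-tuple I) \prod_(i <- t) w j i *
    `[< eps_optimal eps (f j) (run A (O j) s (map pt t)) >]%:R <= C) ->
  2 / 3 * #|J|%:R <= C.
Proof.
move=> Asolves fsco mf Oesgo w0 zE bound.
pose E j := [set v : S * N.-tuple Z | eps_optimal eps (f j) (run A (O j) v.1
  v.2)].
have mE j : measurable (E j).
  have mr := measurable_run A (Oesgo j).1.1 (n := N).
  pose c := inf (range (f j)) + eps.
  have := measurableT_comp (mf j) mr measurableT (measurable_itv `]-oo, c]).
  by rewrite setTI; congr measurable; apply/seteqP; split => v /=; rewrite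
    in_itv.
pose g j s := \sum_(t : N.-tuple I) (\prod_(i <- t) w j i) * \1_(E j) (s,
  [tuple of map pt t]).
have W0 j (t : N.-tuple I) : 0 <= \prod_(i <- t) w j i by apply: prodr_ge0.
have mg j : measurable_fun setT (g j).
  apply: measurable_sum => t; apply: measurable_funM => //.
  have mp : measurable_fun [set: S] (fun s => (s, [tuple of map pt t])).
    exact: measurable_fun_pair.
  have mi : measurable_fun setT (\1_(E j) : S * N.-tuple Z -> R) by exact:
    measurable_indic.
  exact: (measurableT_comp mi mp).
have g0 j s : 0 <= g j s by apply: sumr_ge0 => t _; rewrite mulr_ge0.
have lb j : ((2 / 3)%:E <= \int[P]_s (g j s)%:E)%E.
  rewrite -(product_measure1_finitely_supported P (W0 j)
    (finitely_supported_iid (n := N) (w0 j) (zE j)))//.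
  exact: Asolves.
rewrite -lee_fin; apply: (@le_trans _ _ (\sum_(j : J) \int[P]_s (g j s)%:E)%E).
  apply: (@le_trans _ _ (\sum_(j : J) (2 / 3)%:E)%E).
    by rewrite sumEFin sumr_const mulr_natr.
  exact: lee_sum.
rewrite -ge0_integral_sum//; last 2 first.
- by move=> j; exact/measurable_EFinP.
- by move=> j s _; rewrite lee_fin.
apply: (@le_trans _ _ (\int[P]_s (cst C%:E) s)%E).
  apply: ge0_le_integral => //.
  - by move=> s _; apply: sume_ge0 => j _; rewrite lee_fin.
  - by apply: emeasurable_sum => j; exact/measurable_EFinP.
  - move=> s _ /=; rewrite sumEFin lee_fin.
    apply: le_trans (bound s); apply: ler_sum => j _; apply: ler_sum => t _.
    exact: ler_wpM2l.
rewrite integral_cst// -[leRHS]mule1. by rewrite -(probability_setT P).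
Qed.

(** * Smooth convex functions *)

Section euclidean.
Context (R : realType) (d : nat).
Implicit Types (x y z : 'rV[R]_d) (a : R).

Lemma dotpC x y : dotp x y = dotp y x.
Proof. by apply: eq_bigr => i _; rewrite mulrC. Qed.

Lemma dotpDl x y z : dotp (x + y) z = dotp x z + dotp y z.
Proof. by rewrite -big_split; apply: eq_bigr => i _; rewrite mxE mulrDl. Qed.

Lemma dotpZl a x y : dotp (a *: x) y = a * dotp x y.
Proof. by rewrite [RHS]mulr_sumr; apply: eq_bigr => i _; rewrite mxE mulrA. Qed.

Lemma dotpNl x y : dotp (- x) y = - dotp x y.
Proof. by rewrite -scaleN1r dotpZl mulN1r. Qed.

Lemma dotpBl x y z : dotp (x - y) z = dotp x z - dotp y z.
Proof. by rewrite dotpDl dotpNl. Qed.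

Lemma dotpDr x y z : dotp x (y + z) = dotp x y + dotp x z.
Proof. by rewrite !(dotpC x) dotpDl. Qed.

Lemma dotpZr a x y : dotp x (a *: y) = a * dotp x y.
Proof. by rewrite !(dotpC x) dotpZl. Qed.

Lemma dotpNr x y : dotp x (- y) = - dotp x y.
Proof. by rewrite !(dotpC x) dotpNl. Qed.

Lemma dotpBr x y z : dotp x (y - z) = dotp x y - dotp x z.
Proof. by rewrite !(dotpC x) dotpBl. Qed.

Lemma dotp_delta x i : dotp x (delta_mx 0 i) = x 0 i.
Proof.
rewrite /dotp (bigD1 i)//= big1 ?addr0 => [|j ji]; rewrite mxE eqxx /=.
  by rewrite eqxx mulr1.
by rewrite (negbTE ji) mulr0.
Qed.

Lemma dotp_ge0 x : 0 <= dotp x x.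
Proof. by apply: sumr_ge0 => i _; rewrite -expr2 sqr_ge0. Qed.

Lemma sqr_enorm x : enorm x ^+ 2 = dotp x x.
Proof. by rewrite sqr_sqrtr// dotp_ge0. Qed.

Lemma enorm_ge0 x : 0 <= enorm x. Proof. exact: sqrtr_ge0. Qed.

Lemma cauchy_schwarz x y : `|dotp x y| <= enorm x * enorm y.
Proof.
rewrite -sqrtrM ?dotp_ge0// -sqrtr_sqr ler_wsqrtr//.
have [y0|y0] := eqVneq (dotp y y) 0.
  have yE i : y 0 i = 0.
    move/eqP: y0; rewrite psumr_eq0 => [/allP/(_ i)|j _]; last by
      rewrite -expr2 sqr_ge0.
    by rewrite mem_index_enum => /(_ isT); rewrite mulf_eq0 orbb => /eqP.
  by rewrite y0 mulr0 /dotp big1 ?expr0n// => i _; rewrite yE mulr0.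
have ygt0 : 0 < dotp y y by rewrite lt_neqAle eq_sym y0 dotp_ge0.
(* This vector is [dotp y y] times the component of [x] orthogonal to [y]. *)
have := dotp_ge0 (dotp y y *: x - dotp x y *: y).
rewrite !(dotpBl, dotpBr, dotpZl, dotpZr) (dotpC y x).
rewrite (_ : _ - _ = dotp y y * (dotp x x * dotp y y - dotp x y ^+ 2)); last by
  ring.
by rewrite pmulr_rge0// subr_ge0.
Qed.

Lemma sqr_coord_le x i : x 0 i ^+ 2 <= dotp x x.
Proof.
rewrite /dotp (bigD1 i)//= -expr2 lerDl; apply: sumr_ge0 => j _.
by rewrite -expr2 sqr_ge0.
Qed.

Lemma coord_le_enorm x i : `|x 0 i| <= enorm x.
Proof. by rewrite -sqrtr_sqr ler_wsqrtr// sqr_coord_le. Qed.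

(** Transfers bounds quadratic in the Euclidean norm to the library's sup norm, in which little-o is
    measured. *)
Lemma dotp_le_norm x : dotp x x <= d%:R * `|x| ^+ 2.
Proof.
rewrite -[d in d%:R]card_ord mulr_natl -sumr_const; apply: ler_sum => i _.
rewrite -expr2 -real_normK ?num_real// lerXn2r ?nnegrE//.
rewrite [`|x|]mx_normrE.
exact: (le_bigmax _ (fun j : 'I_1 * 'I_d => `|x j.1 j.2|) (0, i)).
Qed.

End euclidean.

(* The two-sided quadratic bound packs convexity, differentiability and the
   value of the gradient into one algebraic condition. *)
Definition smooth_convex (R : realType) (d : nat) (f : 'rV[R]_d -> R)
    (G : 'rV[R]_d -> 'rV[R]_d) (C : R) :=
  forall x y, 0 <= f y - f x - dotp (G x) (y - x) <= C * dotp (y - x) (y - x).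

Section smooth_convex.
Context (R : realType) (d : nat) (f : 'rV[R]_d -> R)
  (G : 'rV[R]_d -> 'rV[R]_d) (C : R).
Hypothesis fG : smooth_convex f G C.

Let dot_linear x : linear (dotp (G x) : 'rV[R]_d -> R).
Proof. by move=> a u v; rewrite dotpDr dotpZr. Qed.

HB.instance Definition _ x :=
  GRing.isLinear.Build R 'rV[R]_d R _ (dotp (G x)) (dot_linear x).

Let dot_continuous x : continuous (dotp (G x) : 'rV[R]_d -> R).
Proof.
move=> y; apply: differentiable_continuous.
rewrite (_ : dotp (G x) = \sum_(i < d) (fun y : 'rV[R]_d => G x 0 i *: (y 0 i :
  R))).
  by apply: differentiable_sum => i; apply: differentiableZ; exact:
    differentiable_coord.
by apply/funext => z; rewrite fct_sumE.
Qed.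

Let expansion x : f \o shift x = cst (f x) + dotp (G x) +o_ (0 : 'rV[R]_d) id.
Proof.
(* The remainder is at most [K] times the squared sup norm, hence little-o; the [+ 1] keeps [K]
   positive. *)
apply/eqaddoP => e e0; pose K := `|C| * d%:R + 1.
have K0 : 0 < K by rewrite ltr_pwDr// mulr_ge0.
have nK : \forall x \near (0 : 'rV[R]_d), `|x| <= e / K.
  by apply: pseudometric_normed_Zmodule.nbhs0_le; exact: divr_gt0.
near=> h; rewrite /= !fctE /=.
have /andP[lo up] := fG x (h + x); rewrite addrK in lo up.
rewrite opprD addrA ger0_norm//; apply: (le_trans up).
apply: (@le_trans _ _ (K * (`|h| * `|h|))).
  apply: (@le_trans _ _ (`|C| * (d%:R * `|h| ^+ 2))).
    apply: (le_trans (ler_wpM2r (dotp_ge0 _) (ler_norm C))).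
    by rewrite ler_wpM2l// dotp_le_norm.
  by rewrite mulrA expr2 /K mulrDl lerDl mul1r mulr_ge0.
rewrite mulrA ler_wpM2r// mulrC -ler_pdivlMr//.
by near: h.
Unshelve. all: by end_near. Qed.

Lemma smooth_convex_differentiable x : differentiable f x.
Proof.
apply/diff_locallyP; rewrite (diff_unique (@dot_continuous x) (expansion x)).
by split; [exact: (@dot_continuous x)|exact: expansion].
Qed.

Lemma smooth_convex_grad x : grad f x = G x.
Proof.
apply/rowP => i; rewrite mxE deriveE; last exact: smooth_convex_differentiable.
rewrite (diff_unique (@dot_continuous x) (expansion x)); exact: dotp_delta.
Qed.

(** Averaging the tangent inequalities from [z] to [x] and to [y] with weights [t] and [1 - t]
    cancels the linear terms. *)
Lemma smooth_convex_convex :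
  convex_function [set: convex_lmodType 'rV[R]_d] (f : _ -> R^o).
Proof.
move=> t x y _ _; pose z : 'rV[R]_d := t%:num *: (x : 'rV[R]_d) + (1 -
  t%:num) *: (y : 'rV[R]_d).
change (f z <= t%:num * f x + (1 - t%:num) * f y).
have t0 : 0 <= t%:num by [].
have t1 : t%:num <= 1 by [].
have /andP[hx _] := fG z x; have /andP[hy _] := fG z y.
have : 0 <= t%:num * (f x - f z - dotp (G z) (x - z)) +
  (1 - t%:num) * (f y - f z - dotp (G z) (y - z)).
  by rewrite addr_ge0// mulr_ge0// subr_ge0.
have : t%:num * dotp (G z) (x - z) + (1 - t%:num) * dotp (G z) (y - z) = 0.
  rewrite -!dotpZr -dotpDr (_ : _ + _ = 0); first by rewrite /dotp big1// => i
    _; rewrite mxE mulr0.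
  by apply/rowP => i; rewrite !mxE; ring.
lra.
Qed.

Lemma smooth_convex_lipschitz L :
  (forall x, enorm (G x) <= L) -> lipschitz_with L f.
Proof.
move=> GL; suff H x y : f x - f y <= L * enorm (x - y).
  move=> x y; rewrite ler_norml H andbT lerNl opprB (le_trans (H y x))//.
  by rewrite -opprB /enorm dotpNl dotpNr opprK.
have /andP[lo _] := fG x y.
have /(le_trans (ler_norm _)) := cauchy_schwarz (G x) (x - y).
rewrite -[x - y]opprB dotpNr opprB => cs.
have : enorm (G x) * enorm (x - y) <= L * enorm (x - y) by rewrite ler_wpM2r//
  enorm_ge0.
lra.
Qed.

End smooth_convex.

Lemma eps_optimal_min0 (R : realType) (d : nat) (eps : R) (f : 'rV[R]_d -> R)
    (xs x : 'rV[R]_d) :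
  (forall y, 0 <= f y) -> f xs = 0 -> eps_optimal eps f x -> f x <= eps.
Proof.
move=> f0 fxs; rewrite /eps_optimal; suff -> : inf (range f) = 0 by rewrite
  add0r.
apply/eqP; rewrite eq_le; apply/andP; split.
  by rewrite -fxs; apply: ge_inf; [exists 0 => _ [y _ <-]; exact: f0|exists xs].
by apply: lb_le_inf; [exists (f xs), xs|move=> _ [y _ <-]; exact: f0].
Qed.

(** * Smoothed maxima *)

Section ramp.
Context (R : realType).
Implicit Types (e t : R).

(** A continuously differentiable positive part: 0 for [t <= 0], [t ^+ 2 / (2 * e)] on [[0, e]], and
    [t - e / 2] beyond. Its derivative [dramp] is [t / e] clamped to [[0, 1]]. *)
Definition ramp e t : R :=
  (Num.max 0 t ^+ 2 - Num.max 0 (t - e) ^+ 2) / (2 * e).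

Definition dramp e t : R := (Num.max 0 t - Num.max 0 (t - e)) / e.

Lemma dramp_ge0_le1 e t : 0 < e -> 0 <= dramp e t <= 1.
Proof.
move=> e0; rewrite /dramp divr_ge0 ?(ltW e0)//= ?ler_pdivrMr// ?mul1r.
  by rewrite /Num.max; do 2 case: ifPn; lra.
by rewrite /Num.max; do 2 case: ifPn; lra.
Qed.

Lemma dramp_eq0 e t : 0 < e -> t <= 0 -> dramp e t = 0.
Proof.
by move=> e0 t0; rewrite /dramp !max_l ?subrr ?mul0r// subr_le0 (le_trans t0)//
  ltW.
Qed.

Lemma dramp_eq1 e t : 0 < e -> e <= t -> dramp e t = 1.
Proof.
move=> e0 et; rewrite /dramp !max_r ?subr_ge0 ?(le_trans (ltW e0))//.
by rewrite opprB addrC subrK divff// gt_eqF.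
Qed.

Lemma ramp_eq0 e t : 0 < e -> t <= 0 -> ramp e t = 0.
Proof.
by move=> e0 t0; rewrite /ramp !max_l ?subrr ?mul0r// subr_le0 (le_trans t0)//
  ltW.
Qed.

(** The derivative is nondecreasing and [1 / e]-Lipschitz. After scaling by [2 * e], each sign
    pattern of the four maxima is a polynomial inequality. *)
Lemma ramp_quadratic e t t' : 0 < e ->
  0 <= ramp e t' - ramp e t - dramp e t * (t' - t) <= (2 * e)^-1 * (t' - t) ^+
    2.
Proof.
move=> e0; have e2 : 0 < 2 * e by lra.
rewrite (_ : _ - _ - _ = (2 * e)^-1 *
  (Num.max 0 t' ^+ 2 - Num.max 0 (t' - e) ^+ 2 - Num.max 0 t ^+ 2 +
   Num.max 0 (t - e) ^+ 2 - 2 * (Num.max 0 t - Num.max 0 (t - e)) * (t' - t)));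
     last first.
  by rewrite /ramp /dramp; field; rewrite gt_eqF.
rewrite pmulr_rge0 ?invr_gt0// ler_pM2l ?invr_gt0//.
have sq := sqr_ge0 (t' - t).
rewrite /Num.max; do 4 case: ifPn; rewrite -?leNgt => h1 h2 h3 h4; apply/andP;
  split; nra.
Qed.

Lemma ramp_lipschitz e t t' : 0 < e -> t <= t' ->
  0 <= ramp e t' - ramp e t <= t' - t.
Proof.
move=> e0 tt'.
have /andP[h1 _] := ramp_quadratic t t' e0.
have /andP[h2 _] := ramp_quadratic t' t e0.
have /andP[a0 a1] := dramp_ge0_le1 t e0.
have /andP[b0 b1] := dramp_ge0_le1 t' e0.
by apply/andP; split; nra.
Qed.

Lemma ramp_ge0 e t : 0 < e -> 0 <= ramp e t.
Proof.
move=> e0; have [t0|t0] := leP t 0; first by rewrite ramp_eq0.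
have /andP[] := ramp_lipschitz e0 (ltW t0).
by rewrite (ramp_eq0 e0 (lexx 0)) subr0.
Qed.

Lemma ramp_ge e t : 0 < e -> t - e / 2 <= ramp e t.
Proof.
move=> e0; rewrite /ramp ler_pdivlMr; last lra.
by rewrite /Num.max; do 2 case: ifPn; rewrite -?leNgt; nra.
Qed.

Lemma measurable_ramp e : measurable_fun [set: R] (ramp e).
Proof.
apply: measurable_funM; last exact: measurable_cst.
apply: measurable_funB; apply: measurable_funX; apply: measurable_maxr => //.
exact: measurable_funB.
Qed.

Lemma measurable_dramp e : measurable_fun [set: R] (dramp e).
Proof.
apply: measurable_funM; last exact: measurable_cst.
apply: measurable_funB; apply: measurable_maxr => //.
exact: measurable_funB.
Qed.

End ramp.

(* [smoothmax] agrees with [Num.max] when its arguments are at least [e] apart;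
   hence away from near-ties the gradient of the iterated maximum is exactly
   that of one of the terms. *)
Section nested_max.
Context (R : realType) (d : nat) (e : R).
Hypothesis e0 : 0 < e.

Definition smoothmax (a b : R) : R := b + ramp (2 * e) (a - b + e).

Let e2 : 0 < 2 * e. Proof. by rewrite mulr_gt0. Qed.

Lemma smoothmax_mono a b a' b' : a <= a' -> b <= b' ->
  smoothmax a b <= smoothmax a' b'.
Proof.
move=> aa' bb'; apply: (@le_trans _ _ (smoothmax a' b)).
  have t : a - b + e <= a' - b + e by lra.
  by have := ramp_lipschitz e2 t; rewrite /smoothmax; lra.
have t : a' - b' + e <= a' - b + e by lra.
by have := ramp_lipschitz e2 t; rewrite /smoothmax; lra.
Qed.

Lemma smoothmaxB a b c : smoothmax (a - c) (b - c) = smoothmax a b - c.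
Proof. by rewrite /smoothmax (_ : a - c - (b - c) = a - b); [ring|ring]. Qed.

Lemma smoothmax_ger a b : b <= smoothmax a b.
Proof. by rewrite lerDl ramp_ge0. Qed.

Lemma smoothmax_gel a b : a <= smoothmax a b.
Proof. by have := ramp_ge (a - b + e) e2; rewrite /smoothmax; lra. Qed.

Fixpoint nestmax (a : nat -> R) (j : nat) : R :=
  if j is i.+1 then smoothmax (a i) (nestmax a i) else 0.

Lemma nestmax_ge0 a j : 0 <= nestmax a j.
Proof. by elim: j => //= j IH; apply: (le_trans IH); exact: smoothmax_ger. Qed.

Lemma le_nestmax a i j : (i < j)%N -> a i <= nestmax a j.
Proof.
elim: j => // j IH; rewrite ltnS leq_eqVlt => /orP[/eqP->|/IH ij] /=.
  exact: smoothmax_gel.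
by apply: (le_trans ij); exact: smoothmax_ger.
Qed.

Lemma nestmax_eq0 a j : (forall i, (i < j)%N -> a i <= - e) -> nestmax a j = 0.
Proof.
elim: j => //= j IH ale; rewrite IH; last by move=> i ij; apply: ale; exact:
  leqW.
by rewrite /smoothmax ramp_eq0 ?addr0//; have := ale j (ltnSn j); lra.
Qed.

(** [smoothmax] is monotone and commutes with translations. The maximum of the first [j] terms thus
    falls by at most [j * c], while the next term falls by [(j + 1) * c]; [tied_unique] lives on
    this difference. *)
Lemma nestmax_shift a a' c j : 0 <= c ->
  (forall i, a' i = a i - i.+1%:R * c) ->
  nestmax a j - j%:R * c <= nestmax a' j <= nestmax a j.
Proof.
move=> c0 aa'; elim: j => /= [|j /andP[lo up]]; first by lra.
have ic : 0 <= j.+1%:R * c by rewrite mulr_ge0.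
rewrite aa'; apply/andP; split.
  by rewrite -smoothmaxB smoothmax_mono// (le_trans _ lo)// -natr1; lra.
by rewrite smoothmax_mono//; lra.
Qed.

Fixpoint dnestmax (a : nat -> R) (g : nat -> 'rV[R]_d) (j : nat) : 'rV[R]_d :=
  if j is i.+1 then
    dnestmax a g i +
    dramp (2 * e) (a i - nestmax a i + e) *: (g i - dnestmax a g i)
  else 0.

(** Without near-ties every ramp is saturated, so each level either keeps the gradient below it or
    replaces it by [g i]. *)
Lemma dnestmax_untied a g j :
  (forall i, (i < j)%N -> e <= `|a i - nestmax a i|) ->
  dnestmax a g j = 0 \/ exists2 i, (i < j)%N & dnestmax a g j = g i.
Proof.
elim: j => [|j IH] au; first by left.
have := au j (ltnSn j); rewrite /= ler_normr => /orP[h|h].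
  right; exists j => //; rewrite dramp_eq1 ?scale1r; [|by []|lra].
  by rewrite addrC subrK.
rewrite dramp_eq0; [|by []|lra]; rewrite scale0r addr0.
have [i ij|->|[i ij ->]] := IH; [by apply: au; exact: leqW|by left|].
by right; exists i => //; exact: leqW.
Qed.

Section affine.
Variables (a : nat -> 'rV[R]_d -> R) (g : nat -> 'rV[R]_d).
Hypothesis ag : forall i x y, a i y - a i x = dotp (g i) (y - x).
Hypothesis g1 : forall i, dotp (g i) (g i) <= 1.

Let F j x := nestmax (a ^~ x) j.
Let G j x := dnestmax (a ^~ x) g j.

Lemma enorm_le1 (v : 'rV[R]_d) : dotp v v <= 1 -> enorm v <= 1.
Proof. by move=> v1; rewrite -sqrtr1 ler_wsqrtr. Qed.

(** Each level is a convex combination, with weight [t], of two vectors of the unit ball. *)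
Lemma dotp_dnestmax_le1 j x : dotp (G j x) (G j x) <= 1.
Proof.
elim: j => [|j IH]; first by rewrite /G /= /dotp big1// => i _; rewrite mxE
  mul0r.
have /andP[t0 t1] := dramp_ge0_le1 (a j x - F j x + e) e2.
rewrite /G /= -/(G j x); set t := dramp _ _ in t0 t1 *.
have := cauchy_schwarz (G j x) (g j).
have le1 : enorm (G j x) * enorm (g j) <= 1.
  by rewrite mulr_ile1 ?enorm_ge0 ?enorm_le1 ?g1.
move=> /(le_trans (ler_norm _))/le_trans/(_ le1) cs.
rewrite !(dotpDl, dotpDr, dotpZl, dotpZr, dotpNl, dotpNr) (dotpC (g j)).
have := g1 j; have := dotp_ge0 (g j); move: IH cs.
set p := dotp (G j x) _; set q := dotp (g j) _; set z := dotp _ _.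
move=> p1 z1 q0 q1; have ? : 0 <= t * (1 - t) * (1 - z) by apply: mulr_ge0;
  [apply: mulr_ge0|]; lra.
have ? : 0 <= (1 - t) * (1 - t) * (1 - p) by apply: mulr_ge0; [apply:
  mulr_ge0|]; lra.
have ? : 0 <= t * t * (1 - q) by apply: mulr_ge0; [apply: mulr_ge0|]; lra.
nra.
Qed.

(** Each level adds [1 / e] to the constant: its remainder is [1 - t] times that of the level below
    plus that of the ramp, whose argument is 2-Lipschitz as a difference of 1-Lipschitz
    functions. *)
Lemma nestmax_smooth_convex j : smooth_convex (F j) (G j) (j%:R / e).
Proof.
elim: j => [|j IH] x y; first by rewrite /F /G /= /dotp big1 ?mul0r ?subr0
  ?lexx// => i _; rewrite mxE mul0r.
have lipF := smooth_convex_lipschitz IH (fun x => enorm_le1 (dotp_dnestmax_le1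
  j x)) y x.
have /andP[h1 h2] := IH x y.
have := ramp_quadratic (a j x - F j x + e) (a j y - F j y + e) e2.
have := dramp_ge0_le1 (a j x - F j x + e) e2.
rewrite /F /G /= -/(F j x) -/(F j y) -/(G j x) /smoothmax.
set t := dramp _ _ => /andP[t0 t1].
set p := ramp _ _; set q := ramp _ _.
rewrite dotpDl dotpZl dotpBl -ag.
move: h1 h2 lipF; set z := dotp (G j x) _; rewrite mul1r.
have := le_trans (ler_norm _) (cauchy_schwarz (g j) (y - x)).
have := cauchy_schwarz (g j) (y - x).
rewrite -ag; have := enorm_le1 (g1 j); have := enorm_ge0 (y - x); have :=
  sqr_enorm (y - x).
set n := enorm (y - x); set Q := dotp (y - x) _ => nQ n0 gj1.
move=> cs _ h1 h2 lip /andP[r1 r2].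
have agn : `|a j y - a j x| <= n by apply: (le_trans cs); rewrite ler_piMl.
have du : (a j y - F j y + e - (a j x - F j x + e)) ^+ 2 <= 4 * Q.
  rewrite -nQ (_ : 4 * n ^+ 2 = (2 * n) ^+ 2); last by ring.
  rewrite -real_normK ?num_real// lerXn2r ?nnegrE//; first by lra.
  have -> : a j y - F j y + e - (a j x - F j x + e) = (a j y - a j x) - (F j
    y - F j x) by ring.
  by apply: (le_trans (ler_normB _ _)); lra.
have : (2 * (2 * e))^-1 * (a j y - F j y + e - (a j x - F j x + e)) ^+ 2 <=
  e^-1 * Q.
  rewrite (_ : e^-1 * Q = (2 * (2 * e))^-1 * (4 * Q)); last by field; rewrite
    gt_eqF.
  by apply: ler_wpM2l => //; rewrite invr_ge0 !mulr_ge0 // ltW.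
have -> : j.+1%:R / e * Q = j%:R / e * Q + e^-1 * Q by rewrite -natr1; ring.
move: r1 r2; set u := (a j y - F j y + e - (a j x - F j x + e)) => r1 r2 r3.
have Q0 : 0 <= j%:R / e * Q by rewrite mulr_ge0 ?dotp_ge0// divr_ge0// ltW.
set w := F j y - F j x - z in h1 h2.
rewrite (_ : _ - _ - _ = (1 - t) * w + (p - q - t * u)); last by rewrite /w /u;
  ring.
have := mulr_ge0 t0 h1; have : 0 <= (1 - t) * w by rewrite mulr_ge0// subr_ge0.
by move=> ? ?; apply/andP; split; lra.
Qed.

Hypothesis ma : forall i, measurable_fun [set: 'rV[R]_d] (a i).

Lemma measurable_nestmax j : measurable_fun [set: 'rV[R]_d] (F j).
Proof.
elim: j => [|j IH]; first exact: measurable_cst.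
apply: measurable_funD => //; apply: (measurableT_comp (measurable_ramp _)).
by apply: measurable_funD => //; apply: measurable_funB.
Qed.

Lemma measurable_dnestmax j i : measurable_fun [set: 'rV[R]_d] (fun x => G j x
  0 i).
Proof.
elim: j => [|j IH].
  rewrite (_ : (fun _ => _) = cst 0) ?measurable_cst//.
  by apply/funext => x; rewrite /G /= mxE.
rewrite (_ : (fun _ => _) = (fun x => G j x 0 i +
   dramp (2 * e) (a j x - F j x + e) * (g j 0 i - G j x 0 i))); last first.
  by apply/funext => x; rewrite /G /= !mxE.
apply: measurable_funD => //; apply: measurable_funM; last exact:
  measurable_funB.
apply: (measurableT_comp (measurable_dramp _)).
by apply: measurable_funD => //; apply: measurable_funB => //; exact:
  measurable_nestmax.
Qed.

End affine.
End nested_max.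

(** * The dimension term *)

(** The deviation is identically zero: for [t > 0] the event is empty, and for [t = 0] the bound 2
    exceeds every probability. *)
Lemma exact_gradient_esgo (R : realType) (d : nat) (sigma : R)
    (f : 'rV[R]_d -> R) G C dZ (Z : measurableType dZ) (zeta : probability Z R)
      :
  smooth_convex f G C ->
  (forall i, measurable_fun [set: 'rV[R]_d] (fun x => G x 0 i)) ->
  is_esgo sigma f zeta (fun x _ => G x).
Proof.
move=> fG mG; split; first split.
- apply: measurable_fun_rVP => i.
  exact: (measurableT_comp (mG i) measurable_fst).
- move=> x i; rewrite (smooth_convex_grad fG); split; last exact:
  expectation_cst.
  exact: finite_measure_integrable_cst.
move=> x u t _ t0; rewrite (smooth_convex_grad fG) subrr.
rewrite (_ : dotp 0 u = 0) ?normr0; last by rewrite /dotp big1// => i _;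
  rewrite mxE mul0r.
move: t0; rewrite le_eqVlt => /predU1P[<-|t0].
  rewrite mul0r mul0r oppr0 expR0 mulr1 (le_trans (probability_le1 _ _))//.
    by rewrite (_ : [set _ | _] = setT)//; apply/seteqP; split => // z _ /=.
  by rewrite lee_fin ler1n.
rewrite (_ : [set _ | _] = set0) ?measure0 ?lee_fin ?mulr_ge0 ?expR_ge0//.
by apply/seteqP; split => // z /=; rewrite leNgt t0.
Qed.

(** * A maximum that hides a sign vector *)

Section hard_max.
Context (R : realType) (d' : nat).
Let d := d'.+1.
Variables (m K : nat) (r eta L : R).
Hypotheses (md : (m <= d)%N) (eta0 : 0 < eta) (L0 : 0 < L).

Let e := eta / 2.
Let e0 : 0 < e. Proof. by rewrite divr_gt0. Qed.

Implicit Types (s : m.-tuple bool) (k : nat) (x : 'rV[R]_d).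

Let sg s (i : nat) : R := (-1) ^+ nth false s i.

Let sgK s i : sg s i * sg s i = 1.
Proof. by rewrite /sg -expr2 sqrr_sign. Qed.

(* The shift grows with [i], so that for each [i] a fixed query is near the
   [i]-th kink for at most one value of [k]. *)
Definition piece s k (i : nat) x : R :=
  r - sg s i * x 0 (inord i) - i.+1%:R * (k.+1%:R * eta).

Definition dpiece s (i : nat) : 'rV[R]_d := - sg s i *: delta_mx 0 (inord i).

Let pieceB s k i x y : piece s k i y - piece s k i x = dotp (dpiece s i) (y -
  x).
Proof. by rewrite /dpiece dotpZl dotpC dotp_delta !mxE /piece; ring. Qed.

Let dpiece1 s i : dotp (dpiece s i) (dpiece s i) <= 1.
Proof.
by rewrite dotpZl dotpZr dotp_delta mxE !eqxx mulr1 mulrNN sgK.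
Qed.

Definition hard_max s k x := L * nestmax e (piece s k ^~ x) m.
Definition hard_grad s k x := L *: dnestmax e (piece s k ^~ x) (dpiece s) m.

Lemma hard_max_smooth_convex s k :
  smooth_convex (hard_max s k) (hard_grad s k) (L * (m%:R / e)).
Proof.
move=> x y.
have /andP[lo up] := nestmax_smooth_convex e0 (pieceB s k) (dpiece1 s) m x y.
rewrite /hard_max /hard_grad dotpZl -!mulrBr -mulrA.
by rewrite pmulr_rge0// lo ler_pM2l.
Qed.

Lemma measurable_piece s k i : measurable_fun [set: 'rV[R]_d] (piece s k i).
Proof.
apply: measurable_funB; last exact: measurable_cst.
apply: measurable_funB => //; apply: measurable_funM => //.
exact: measurable_coord.
Qed.

Lemma measurable_hard_max s k : measurable_fun [set: 'rV[R]_d] (hard_max s k).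
Proof.
by apply: measurable_funM => //; apply: measurable_nestmax => i; exact:
  measurable_piece.
Qed.

Lemma measurable_hard_grad s k i :
  measurable_fun [set: 'rV[R]_d] (fun x => hard_grad s k x 0 i).
Proof.
rewrite (_ : (fun _ => _) =
  (fun x => L * dnestmax e (piece s k ^~ x) (dpiece s) m 0 i)); last first.
  by apply/funext => x; rewrite mxE.
apply: measurable_funM => //; apply: measurable_dnestmax => j.
exact: measurable_piece.
Qed.

Definition hard_argmin s : 'rV[R]_d :=
  \row_j (if (j < m)%N then sg s j * r else 0).

(** At this point each piece equals minus its shift, at most [- eta], which is far enough below 0
    for the smoothing to vanish. *)
Lemma hard_max_argmin s k : hard_max s k (hard_argmin s) = 0.
Proof.
rewrite /hard_max nestmax_eq0 ?mulr0// => i im.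
have i_d : (i < d)%N by exact: leq_trans im md.
rewrite /piece mxE inordK// im mulrA sgK mul1r subrr sub0r lerN2.
apply: (@le_trans _ _ eta); first by have := eta0; rewrite /e; lra.
by rewrite mulrA ler_peMl ?(ltW eta0)// -natrM ler1n.
Qed.

Lemma hard_max_ge0 s k x : 0 <= hard_max s k x.
Proof. by rewrite mulr_ge0 ?(ltW L0)// nestmax_ge0. Qed.

Lemma hard_max_sco rad s k : 0 <= rad -> m%:R * r ^+ 2 <= rad ^+ 2 ->
  sco_instance rad L (hard_max s k).
Proof.
move=> rad0 mr; have fG := hard_max_smooth_convex s k; split.
- exact: smooth_convex_differentiable fG.
- exact: smooth_convex_convex fG.
- apply: (smooth_convex_lipschitz fG) => x; rewrite /enorm dotpZl dotpZr
  mulrA -expr2.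
  rewrite sqrtrM ?sqr_ge0// sqrtr_sqr gtr0_norm// ler_piMr// ?(ltW L0)//.
  exact/enorm_le1/(dotp_dnestmax_le1 e0).
- exists (hard_argmin s); split=> [y|]; first by rewrite hard_max_argmin
  hard_max_ge0.
  rewrite -(ger0_norm rad0) -sqrtr_sqr ler_wsqrtr// (le_trans _ mr)//.
  rewrite /dotp (eq_bigr (fun j : 'I_d => if (j < m)%N then r ^+ 2 else 0)).
    by rewrite -big_mkcond -(big_ord_widen _ (fun=> r ^+ 2) md) sumr_const
      card_ord mulr_natl.
  move=> j _; rewrite mxE; case: ifP => _; last by rewrite mul0r.
  by rewrite mulrACA sgK mul1r expr2.
Qed.

(** Optimality bounds every piece by [eps / L]; the shifts are at most [m * (K * eta)], so the gap
    forces [s_i * x_i > 0]. The bit [true] stands for the sign -1. *)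
Lemma hard_max_optimal s k eps x : (k < K)%N ->
  m%:R * (K%:R * eta) < r - eps / L ->
  eps_optimal eps (hard_max s k) x ->
  s = [tuple x 0 (inord i) < 0 | i < m].
Proof.
move=> kK gap /(eps_optimal_min0 (hard_max_ge0 s k) (hard_max_argmin s k)) xe.
have opt i : (i < m)%N -> 0 < sg s i * x 0 (inord i).
  move=> im; have := le_trans (le_nestmax e0 (piece s k ^~ x) im) _.
  have nle : nestmax e (piece s k ^~ x) m <= eps / L by rewrite ler_pdivlMr//
    mulrC.
  move/(_ _ nle); rewrite /piece.
  have : i.+1%:R * (k.+1%:R * eta) <= m%:R * (K%:R * eta).
    by rewrite !mulrA ler_wpM2r ?(ltW eta0)// -!natrM ler_nat leq_mul.
  lra.
apply: eq_from_tnth => i; rewrite tnth_mktuple (tnth_nth false).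
have := opt i (ltn_ord i); rewrite /sg; case: nth => /=.
  by rewrite expr1 mulN1r oppr_gt0 => ->.
by rewrite expr0 mul1r => x0; rewrite ltNge (ltW x0).
Qed.

Definition tied s k x (i : nat) := `|piece s k i x - nestmax e (piece s k ^~ x)
  i| < e.

(** From [k] to a larger [k'], [piece i] falls by [(i + 1) * c] and the maximum below it by at most
    [i * c]. Their difference falls by at least [c >= eta = 2 * e], too much for both values to lie
    within [e] of 0. *)
Lemma tied_unique s k k' x i : tied s k x i -> tied s k' x i -> k = k'.
Proof.
wlog kk' : k k' / (k < k')%N.
  move=> W t t'; have [kk'|kk'|//] := ltngtP k k'; first exact: W.
  by apply/esym; exact: W.
rewrite /tied !ltr_norml => /andP[_ t1] /andP[t2 _]; exfalso.
pose c := (k' - k)%:R * eta.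
have cE : k'.+1%:R * eta = k.+1%:R * eta + c.
  by rewrite /c -mulrDl -natrD addSn subnKC// ltnW.
have c_eta : eta <= c by rewrite /c ler_peMl ?(ltW eta0)// ler1n subn_gt0.
have c0 : 0 <= c by rewrite (le_trans (ltW eta0)).
have sh j : piece s k' j x = piece s k j x - j.+1%:R * c by rewrite /piece cE;
  ring.
have /andP[lo _] := nestmax_shift e0 i c0 sh.
have : e + e = eta by rewrite /e; lra.
move: t1 t2; rewrite sh -natr1; lra.
Qed.

Let alphabet := option ('I_m * bool).

Definition letter (l : alphabet) : 'rV[R]_d :=
  if l is Some (i, b) then - L * (-1) ^+ b *: delta_mx 0 (inord i) else 0.

Lemma hard_grad_letter s k x :
  (forall i, (i < m)%N -> ~~ tied s k x i) -> exists l, hard_grad s k x =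
    letter l.
Proof.
move=> ut; rewrite /hard_grad; have [i im|->|[i im ->]] := @dnestmax_untied R d
  e e0 (piece s k ^~ x) (dpiece s) m.
- by have := ut i im; rewrite /tied -leNgt.
- by exists None; rewrite scaler0.
- exists (Some (Ordinal im, nth false s i)).
  by rewrite /dpiece scalerA /= mulrN mulNr.
Qed.

(** * Counting ties and transcripts *)

Section counting.
Context (dS : measure_display) (S : measurableType dS).
Variables (A : algorithm R d S) (N : nat) (seed : S).

(** A place where a tie may occur: a word of answers, the time at which it is cut, and a level of
    the maximum. Nodes do not depend on [s] and [k], which permits a union bound over all of
    them. *)
Let node := (N.-tuple alphabet * 'I_N * 'I_m)%type.

Let node_tied s k (p : node) :=
  tied s k (query A seed (map letter (take p.1.2 p.1.1))) p.2.

Let bad s k := [exists p, node_tied s k p].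

Let good_answers s k (t : seq unit) : ~~ bad s k -> size t = N ->
  exists h : N.-tuple alphabet,
    answers A (fun x _ => hard_grad s k x) seed t = map letter h.
Proof.
move=> nbad tN.
suff H (t' : seq unit) : (size t' <= N)%N -> exists h : seq alphabet,
    size h = size t' /\ answers A (fun x _ => hard_grad s k x) seed t' = map
      letter h.
  have [|h [sh ah]] := H t; first by rewrite tN.
  have /eqP hN : size h = N by rewrite sh.
  by exists (Tuple hN).
elim/last_ind: t' => [|t' z IH]; first by exists [::].
rewrite size_rcons => t'N; have [|h [sh ah]] := IH; first exact: ltnW.
(* Padding with [None] turns the partial transcript into a word of length [N]; the [take] in
   [node_tied] removes the padding. *)
have pN : size (h ++ nseq (N - size t') None) == N.
  by rewrite size_cat size_nseq sh subnKC// ltnW.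
pose x := query A seed (map letter h).
have [i im|l xl] := @hard_grad_letter s k x.
  apply: contra nbad => ti; apply/existsP.
  exists ((Tuple pN, Ordinal t'N), Ordinal im).
  by rewrite /node_tied /= -sh take_size_cat.
exists (rcons h l); rewrite !size_rcons sh; split => //.
by rewrite answers_rcons ah map_rcons -xl.
Qed.

(** First term: for fixed [s], each node is tied for at most one [k]. Second term: for fixed [k], a
    successful run without ties determines [s] from its word of answers, so there are at most as
    many such [s] as words. *)
Lemma card_success eps : m%:R * (K%:R * eta) < r - eps / L ->
  \sum_(p : m.-tuple bool * 'I_K) \sum_(t : N.-tuple unit)
    `[< eps_optimal eps (hard_max p.1 p.2)
        (run A (fun x _ => hard_grad p.1 p.2 x) seed (map id t)) >]%:R <=
  (2 ^ m * ((m * 2).+1 ^ N * N * m) + K * (m * 2).+1 ^ N)%:R :> R.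
Proof.
move=> gap; have cardA : #|{: N.-tuple alphabet}| = ((m * 2).+1 ^ N)%N.
  by rewrite card_tuple card_option card_prod card_ord card_bool.
rewrite exchange_big/=; set bound := (X in _ <= X).
(* The noise space is [unit], so there is exactly one noise tuple. *)
have -> : bound = \sum_(t : N.-tuple unit) bound.
  by rewrite sumr_const card_tuple card_unit exp1n.
apply: ler_sum => t _; rewrite {}/bound map_id.
pose succ (p : m.-tuple bool * 'I_K) := `[< eps_optimal eps (hard_max p.1 p.2)
  (run A (fun x _ => hard_grad p.1 p.2 x) seed t) >].
rewrite -[leLHS]/(\sum_p (succ p)%:R) -natr_sum ler_nat.
have badS s (k : 'I_K) : (bad s k <= \sum_p node_tied s k p)%N.
  rewrite /bad; case: existsP => // -[p tp].
  by rewrite (bigD1 p)//= tp leq_addr.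
have succS s (k : 'I_K) :
    (succ (s, k) <= \sum_p node_tied s k p + (~~ bad s k && succ (s, k)))%N.
  apply: leq_trans (leq_add (badS s k) (leqnn _)).
  by case: (bad s k) => //=; exact: leq_b1.
apply: (@leq_trans (\sum_(p : m.-tuple bool * 'I_K)
    (\sum_q node_tied p.1 p.2 q + (~~ bad p.1 p.2 && succ p)))).
  by apply: leq_sum => -[s k] _; exact: succS.
rewrite big_split /=; apply: leq_add.
  rewrite -(pair_bigA _ (fun s (k : 'I_K) => \sum_q node_tied s k q)%N)/=.
  rewrite -[X in (_ <= X ^ _ * _)%N]card_bool -card_tuple -sum_nat_const.
  apply: leq_sum => s _; rewrite exchange_big/=.
  have -> : ((m * 2).+1 ^ N * N * m = #|{: node}|)%N by rewrite !card_prod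
    cardA !card_ord.
  rewrite -sum1_card; apply: leq_sum => q _.
  rewrite -big_mkcond /= sum1_card; apply/card_le1P => k tk k'.
  rewrite [RHS]inE; apply/idP/eqP => [tk'|->//].
  by apply/val_inj; exact: (tied_unique tk' tk).
rewrite -(pair_bigA _ (fun s (k : 'I_K) => (~~ bad s k && succ (s, k) :
  nat)))/=.
rewrite exchange_big/= -[X in (_ <= X * _)%N]card_ord -sum_nat_const.
apply: leq_sum => k _; rewrite -big_mkcond/= sum1_card -cardA.
pose dec (h : N.-tuple alphabet) :=
  [tuple (output A seed (map letter h)) 0 (inord i) < 0 | i < m].
apply: leq_trans (leq_image_card dec predT).
apply/subset_leq_card/fintype.subsetP => s; rewrite unfold_in => /andP[nbad
  /asboolP sx].
have [h ah] := good_answers nbad (size_tuple t).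
apply/fintype.imageP; exists h => //; rewrite /dec -ah.
exact: (hard_max_optimal _ gap sx).
Qed.

End counting.
End hard_max.

Lemma solves_counting (R : realType) (d : nat) (rad L sigma eps r : R)
    (dS : measure_display) (S : measurableType dS) (P : probability S R)
    (A : algorithm R d S) (N m : nat) :
  solves rad L sigma eps P A N -> 0 <= rad -> 0 < L ->
  (0 < m <= d)%N -> m%:R * r ^+ 2 <= rad ^+ 2 -> eps / L < r ->
  (7 * 2 ^ m <= 12 * (m * 2).+1 ^ N)%N.
Proof.
case: d A => [|d'] A; first by case: m.
move=> Asolves rad0 L0 /andP[m0 md] mr er.
(* [K > 12 * Q] makes ties cost at most a twelfth of the [2 ^ m * K] pairs, and [2/3 - 1/12 = 7/12].
   The [eta] below spends half of the slack [r - eps / L] on the shifts. *)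
set q := ((m * 2).+1 ^ N)%N; pose Q := (q * N * m)%N; pose K := (12 * Q).+1.
pose eta := (r - eps / L) / (2 * (m%:R * K%:R)).
have mK0 : 0 < m%:R * K%:R :> R by rewrite mulr_gt0 ?ltr0n.
have eta0 : 0 < eta by rewrite divr_gt0 ?subr_gt0// mulr_gt0.
have gap : m%:R * (K%:R * eta) < r - eps / L.
  rewrite (_ : _ * _ = (r - eps / L) / 2); first by lra.
  by rewrite /eta; field; rewrite !gt_eqF ?ltr0n.
have fs : finitely_supported (fun=> 1) (id : unit -> unit) (\d_tt : probability
  unit R).
  by move=> B _; rewrite (big_pred1 tt) ?mul1e// => -[].
have avg := solves_average (J := (m.-tuple bool * 'I_K)%type) Asolves
  (f := fun p => hard_max r eta L p.1 p.2)
  (O := fun p x _ => hard_grad r eta L p.1 p.2 x)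
  (fun p => hard_max_sco md eta0 L0 p.1 p.2 rad0 mr)
  (fun p => measurable_hard_max r eta L p.1 p.2)
  (fun p => exact_gradient_esgo sigma _ (hard_max_smooth_convex r eta0 L0 p.1
    p.2)
     (measurable_hard_grad r eta L p.1 p.2))
  (fun _ _ => ler01) (fun=> fs)
  (C := (2 ^ m * Q + K * q)%:R).
have {avg} : 2 / 3 * #|{: m.-tuple bool * 'I_K}|%:R <= (2 ^ m * Q + K * q)%:R
  :> R.
  apply: avg => s; under eq_bigr do under eq_bigr do rewrite big1// mul1r.
  exact: (card_success md eta0 L0 A N s gap).
rewrite card_prod card_tuple card_bool card_ord => bound.
have {}bound : (2 * (2 ^ m * K) <= 3 * (2 ^ m * Q + K * q))%N.
  by rewrite -(ler_nat R) !natrM; move: bound; rewrite natrM; lra.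
have K0 : (0 < K)%N by [].
rewrite -(leq_pmul2l K0).
have : (2 ^ m * (12 * Q) <= 2 ^ m * K)%N by rewrite leq_mul2l leqnSn orbT.
clear -bound; move: (2 ^ m)%N bound => a; clearbody K Q q; nia.
Qed.

(** * Chi-square bounds *)

Lemma sum_tuple_prod (R : comNzRingType) (I : finType) (N : nat) (F : I -> R) :
  \sum_(t : N.-tuple I) \prod_(i <- t) F i = (\sum_i F i) ^+ N.
Proof.
elim: N => [|N IH]; first by rewrite (big_pred1 [tuple]) ?big_nil// => t;
  apply/esym/eqP; rewrite [t]tuple0.
rewrite big_tuple_cons exprS mulr_suml; apply: eq_bigr => i _.
by rewrite -IH mulr_sumr; apply: eq_bigr => t _; rewrite big_cons.
Qed.

Section chi_square.
Context (R : realType) (T : finType).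
Implicit Types p q y : T -> R.

Definition chi2 p q : R := \sum_t (p t - q t) ^+ 2 / q t.

Lemma chi2E p q : (forall t, q t != 0) -> \sum_t p t = 1 -> \sum_t q t = 1 ->
  chi2 p q = \sum_t p t ^+ 2 / q t - 1.
Proof.
move=> q0 p1 q1; rewrite /chi2.
rewrite (eq_bigr (fun t => p t ^+ 2 / q t - (2 * p t - q t))) => [|t _]; last
  by field.
by rewrite !sumrB -mulr_sumr p1 q1; ring.
Qed.

(** Termwise [2 u v <= a u^2 + v^2 / a], the slack being a perfect square; the parameter [a] is
    tuned at each use. *)
Lemma sum_diff_le_chi2 p q y a M : (forall t, 0 < q t) -> \sum_t q t = 1 ->
  0 < a -> (forall t, `|y t| <= M) ->
  \sum_t (p t - q t) * y t <= a / 2 * chi2 p q + M ^+ 2 / (2 * a).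
Proof.
move=> q0 q1 a0 yM.
have -> : M ^+ 2 / (2 * a) = \sum_t q t * (M ^+ 2 / (2 * a)) by
  rewrite -mulr_suml q1 mul1r.
rewrite /chi2 mulr_sumr -big_split.
apply: ler_sum => t _ /=; have qt := q0 t.
have yM2 : y t ^+ 2 <= M ^+ 2 by rewrite -real_normK ?num_real// lerXn2r
  ?nnegrE// (le_trans _ (yM t)).
apply: (@le_trans _ _ (a / 2 * ((p t - q t) ^+ 2 / q t) + q t * (y t ^+ 2 /
  (2 * a)))); last first.
  rewrite lerD2l ler_wpM2l ?(ltW qt)// ler_wpM2r// invr_ge0; lra.
rewrite -subr_ge0 (_ : _ - _ = (a * (p t - q t) - q t * y t) ^+ 2 / (2 * a * q
  t)); last first.
  by field; rewrite !gt_eqF.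
by rewrite divr_ge0 ?sqr_ge0// !mulr_ge0 ?(ltW qt) ?(ltW a0).
Qed.

(** Le Cam's two-point method: replacing [p] by [q] on [E] costs the chi-square term, and under [q]
    disjoint events have total mass at most 1. *)
Lemma two_point_bound p q (E F : pred T) a : (forall t, 0 < q t) -> \sum_t q t
  = 1 ->
  0 < a -> (forall t, E t -> F t -> False) ->
  \sum_t p t * (E t)%:R + \sum_t q t * (F t)%:R <= 1 + a / 2 * chi2 p q + 1 /
    (2 * a).
Proof.
move=> q0 q1 a0 EF.
have := @sum_diff_le_chi2 p q (fun t => (E t)%:R) a 1 q0 q1 a0.
rewrite expr1n => /(_ _); have E1 t : `|(E t)%:R : R| <= 1 by case: (E t);
  rewrite ?normr1 ?normr0.
move=> /(_ E1) H.
have : \sum_t q t * (E t)%:R + \sum_t q t * (F t)%:R <= 1.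
  rewrite -[leRHS]q1 -big_split; apply: ler_sum => t _ /=; rewrite -mulrDr
    ler_piMr ?(ltW (q0 t))//.
  by have := EF t; case: (E t); case: (F t) => //= C; rewrite ?addr0 ?add0r//;
    case: C.
have : \sum_t (p t - q t) * (E t)%:R = \sum_t p t * (E t)%:R - \sum_t q t * (E
  t)%:R.
  by rewrite -sumrB; apply: eq_bigr => t _; rewrite mulrBl.
lra.
Qed.

End chi_square.

(** * Assouad's method on the hypercube *)

Section hypercube.
Context (R : realType) (d : nat).
Implicit Types (s : {ffun 'I_d -> bool}) (i : 'I_d).

Definition sgn s i : R := (-1) ^+ s i.

Lemma sgn_sqr s i : sgn s i * sgn s i = 1.
Proof. by rewrite /sgn -expr2 sqrr_sign. Qed.

Lemma normr_sgn s i : `|sgn s i| = 1.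
Proof. by rewrite /sgn normrX normrN1 expr1n. Qed.

Definition flip i s : {ffun 'I_d -> bool} := [ffun j => (j == i) (+) s j].

Lemma flipK i : involutive (flip i).
Proof. by move=> s; apply/ffunP => j; rewrite !ffunE addbA addbb. Qed.

Lemma sgn_flip s i j : sgn (flip i s) j = if j == i then - sgn s j else sgn s j.
Proof.
rewrite /sgn ffunE; case: eqP => _ //=.
by rewrite signrN.
Qed.

(* Assouad's method with a quadratic score: the [i]-th cross term of the square
   changes sign when [s_i] is flipped, so under the uniform prior it is
   controlled by the chi-square divergence of this flip. *)
Lemma assouad (T : finType) (W : {ffun 'I_d -> bool} -> T -> R)
    (y : 'I_d -> T -> R) (X a : R) :
  (0 < d)%N -> (forall s t, 0 < W s t) -> (forall s, \sum_t W s t = 1) ->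
  (forall s i, chi2 (W s) (W (flip i s)) <= X) ->
  (forall i t, `|y i t| <= 1) -> 0 < a ->
  \sum_s \sum_t W s t * (\sum_i y i t * sgn s i) ^+ 2 <=
  (2 ^ d)%:R * (d%:R + d%:R ^+ 2 * ((a * X + a^-1) / 4)).
Proof.
move=> d0 W0 W1 WX y1 a0.
pose U i s t := \sum_(j | j != i) y j t * sgn s j.
have U_le i s t : `|sgn s i * y i t * U i s t| <= d%:R.
  rewrite !normrM normr_sgn mul1r (le_trans (ler_piMl _ (y1 i t)))//.
  apply: (le_trans (ler_norm_sum _ _ _)).
  apply: (@le_trans _ _ (\sum_(j | j != i) 1)).
    by apply: ler_sum => j _; rewrite normrM normr_sgn mulr1.
  rewrite sumr_const ler_nat (leq_trans (max_card _))// card_ord//.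
have U_flip i s t : U i (flip i s) t = U i s t.
  by apply: eq_bigr => j ji; rewrite sgn_flip (negbTE ji).
have sqrE s t : (\sum_i y i t * sgn s i) ^+ 2 =
    \sum_i (y i t ^+ 2 + sgn s i * y i t * U i s t).
  rewrite expr2 mulr_suml; apply: eq_bigr => i _.
  rewrite [X in _ * X](bigD1 i)//= -/(U i s t) mulrDr mulrACA sgn_sqr
    mulr1 -expr2.
  by rewrite [y i t * _]mulrC.
have cross i : \sum_s \sum_t W s t * (sgn s i * y i t * U i s t) <=
    (2 ^ d)%:R * (d%:R * ((a * X + a^-1) / 4)).
  set V := (X in X <= _).
  (* Reindexing by [flip i] negates [sgn s i] and fixes [U], so [V + V] tests [W s - W (flip i s)]
     against a function bounded by [d]. *)
  have VE : V = \sum_s \sum_t - W (flip i s) t * (sgn s i * y i t * U i s t).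
    rewrite /V (reindex_inj (inv_inj (flipK i))); apply: eq_bigr => s _.
    by apply: eq_bigr => t _; rewrite sgn_flip eqxx U_flip; ring.
  have : V + V <= \sum_(s : {ffun 'I_d -> bool}) (d%:R * a / 2 * X + d%:R ^+ 2
    / (2 * (d%:R * a))).
    rewrite {2}VE /V -big_split; apply: ler_sum => s _ /=; rewrite -big_split
      /=.
    under eq_bigr do rewrite -mulrDl.
    (* The parameter [d * a] matches that bound, so that both resulting terms are linear in [d]. *)
    have da : 0 < d%:R * a by rewrite mulr_gt0 ?ltr0n.
    apply: (le_trans (sum_diff_le_chi2 (W s) (W0 (flip i s)) (W1 (flip i s)) da
      (U_le i s))).
    by rewrite lerD2r ler_wpM2l ?WX// divr_ge0// ltW.
  rewrite sumr_const card_ffun card_bool card_ord -[X in _ <= X]mulr_natl.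
  rewrite (_ : d%:R * a / 2 * X + _ = 2 * (d%:R * ((a * X + a^-1) / 4))); last
    first.
    by field; rewrite !gt_eqF ?ltr0n.
  by move: (2 ^ d)%:R => n; lra.
under eq_bigr do under eq_bigr do rewrite sqrE mulr_sumr.
under eq_bigr do rewrite exchange_big/=.
rewrite exchange_big/= (_ : _ * _ = \sum_(i < d) ((2 ^ d)%:R * (1 + d%:R *
  ((a * X + a^-1) / 4)))); last first.
  by rewrite sumr_const card_ord -mulr_natl; ring.
apply: ler_sum => i _; under eq_bigr do under eq_bigr do rewrite mulrDr.
under eq_bigr do rewrite big_split/=.
rewrite big_split/= [leRHS]mulrDr lerD// mulr1.
have -> : (2 ^ d)%:R = \sum_(s : {ffun 'I_d -> bool}) (1 : R).
  by rewrite sumr_const card_ffun card_bool card_ord.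
apply: ler_sum => s _; rewrite -[leRHS](W1 s); apply: ler_sum => t _.
apply: ler_piMr; first exact: ltW.
by rewrite -real_normK ?num_real// exprn_ile1.
Qed.

End hypercube.

(** * Biased bits *)

Section bit_laws.
Context (R : realType) (d : nat) (rho : R).
Hypothesis rho_bd : 0 < rho <= 1 / 2.
Implicit Types (s t : {ffun 'I_d -> bool}) (j : 'I_d) (b : bool).

Definition bit_weight s j b : R := (1 + rho * (sgn R s j * (-1) ^+ b)) / 2.

Definition bits_weight s t : R := \prod_j bit_weight s j (t j).

Lemma sgn_bit s j b : sgn R s j * (-1) ^+ b = (-1) ^+ (s j (+) b).
Proof. by rewrite /sgn signr_addb. Qed.

Lemma bit_weight_gt0 s j b : 0 < bit_weight s j b.
Proof.
have := rho_bd; rewrite /bit_weight sgn_bit => /andP[r0 r1].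
by case: (s j (+) b); rewrite ?expr0 ?expr1; lra.
Qed.

Lemma sum_bit_weight s j : \sum_b bit_weight s j b = 1.
Proof. by rewrite big_bool /bit_weight /= expr0 expr1; field. Qed.

Lemma sum_bit_weightM s j (c : R) : \sum_b bit_weight s j b * c = c.
Proof. by rewrite -[RHS]mul1r -(sum_bit_weight s j) mulr_suml. Qed.

Lemma mean_bit_weight s j : \sum_b bit_weight s j b * (-1) ^+ b = rho * sgn R s
  j.
Proof. by rewrite big_bool /bit_weight /= expr0 expr1; field. Qed.

Lemma bits_weight_gt0 s t : 0 < bits_weight s t.
Proof. by apply: prodr_gt0 => j _; exact: bit_weight_gt0. Qed.

Lemma sum_bits_weightM s (F : 'I_d -> bool -> R) :
  \sum_t bits_weight s t * \prod_j F j (t j) =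
  \prod_j \sum_b bit_weight s j b * F j b.
Proof.
rewrite (bigA_distr_bigA (fun j b => bit_weight s j b * F j b)).
by apply: eq_bigr => t _; rewrite -big_split.
Qed.

Lemma sum_bits_weight s : \sum_t bits_weight s t = 1.
Proof.
transitivity (\sum_t bits_weight s t * \prod_(j < d) 1).
  by apply: eq_bigr => t _; rewrite big1// mulr1.
rewrite (sum_bits_weightM s (fun _ _ => 1)) big1// => j _.
by rewrite sum_bit_weightM.
Qed.

Lemma mean_bits_weight s j : \sum_t bits_weight s t * sgn R t j = rho * sgn R s
  j.
Proof.
pose F (k : 'I_d) b : R := if k == j then (-1) ^+ b else 1.
transitivity (\sum_t bits_weight s t * \prod_k F k (t k)).
  apply: eq_bigr => t _; congr (_ * _); rewrite (bigD1 j)//= big1 ?mulr1 /F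
    ?eqxx//.
  by move=> k /negbTE ->.
rewrite sum_bits_weightM (bigD1 j)//= [X in _ * X]big1 => [|k kj].
  by rewrite mulr1 /F eqxx mean_bit_weight.
by rewrite /F (negbTE kj) sum_bit_weightM.
Qed.

(** [expR (- x) >= 1 - x] gives [expR x <= 1 / (1 - x)], and [(1 + x + 2 x^2) (1 - x) - 1 = x^2 (1 -
    2 x)]. *)
Lemma expR_le_quadratic (x : R) : `|x| <= 1 / 2 -> expR x <= 1 + x + 2 * x ^+ 2.
Proof.
rewrite ler_norml => /andP[x1 x2].
have h := expR_ge1Dx (- x); have e0 := expR_gt0 x.
have : expR x * expR (- x) = 1 by rewrite expRN divff// gt_eqF.
have x1' : 0 < 1 - x by lra.
have : expR x * (1 - x) <= expR x * expR (- x) by rewrite ler_wpM2l ?(ltW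
  e0)//; lra.
move=> e1 e2; rewrite e2 in e1; rewrite -(ler_pM2r x1'); apply: (le_trans e1).
rewrite -subr_ge0 (_ : _ - _ = x ^+ 2 * (1 - 2 * x)); last by ring.
by rewrite mulr_ge0 ?sqr_ge0//; lra.
Qed.

(** The centred bit is bounded by 2, so the exponent stays within [1/2] and [expR_le_quadratic]
    applies; the linear term has mean 0. *)
Lemma mgf_bit_weight s j (y : R) : `|y| <= 1 / 4 ->
  \sum_b bit_weight s j b * expR (y * ((-1) ^+ b - rho * sgn R s j)) <= expR
    (8 * y ^+ 2).
Proof.
move=> y4; pose x b := y * ((-1) ^+ b - rho * sgn R s j).
have xle b : `|x b| <= 2 * `|y|.
  rewrite /x normrM mulrC ler_wpM2r//; apply: (le_trans (ler_normB _ _)).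
  rewrite normrM normr_sgn normrX normrN1 expr1n mulr1.
  have := rho_bd => /andP[r0 r1]; rewrite gtr0_norm//; lra.
apply: (le_trans _ (expR_ge1Dx _)).
apply: (@le_trans _ _ (\sum_b bit_weight s j b * (1 + x b + 8 * y ^+ 2))).
  apply: ler_sum => b _; rewrite ler_wpM2l ?(ltW (bit_weight_gt0 _ _ _))//.
  apply: (le_trans (expR_le_quadratic _)); first by have := xle b; rewrite -/(x
    b); lra.
  rewrite lerD2l (_ : 8 * _ = 2 * (2 * `|y|) ^+ 2).
    rewrite ler_wpM2l// -[x b ^+ 2]real_normK ?num_real// lerXn2r ?nnegrE
      ?mulr_ge0//.
  by rewrite exprMn real_normK ?num_real//; ring.
under eq_bigr do rewrite mulrDr mulrDr.
rewrite !big_split/= !sum_bit_weightM.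
rewrite (_ : \sum_b _ = 0) ?addr0// /x.
transitivity (y * (\sum_b bit_weight s j b * (-1) ^+ b - (\sum_b bit_weight s j
  b) * (rho * sgn R s j))).
  by rewrite mulr_suml -sumrB mulr_sumr; apply: eq_bigr => b _; rewrite -mulrBr
    mulrCA.
by rewrite mean_bit_weight sum_bit_weight mul1r subrr mulr0.
Qed.

Lemma mgf_bits_weight s (y : 'I_d -> R) : (forall j, `|y j| <= 1 / 4) ->
  \sum_t bits_weight s t * expR (\sum_j y j * (sgn R t j - rho * sgn R s j)) <=
  expR (8 * \sum_j y j ^+ 2).
Proof.
move=> y4; under eq_bigr do rewrite expR_sum.
rewrite (sum_bits_weightM s (fun j b => expR (y j * ((-1) ^+ b - rho * sgn R s
  j)))).
rewrite mulr_sumr expR_sum; apply: ler_prod => j _.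
rewrite mgf_bit_weight// andbT; apply: sumr_ge0 => b _.
by rewrite mulr_ge0 ?expR_ge0// ltW// bit_weight_gt0.
Qed.

(** Chernoff's bound for both signs. The cap on [u] comes from [mgf_bits_weight] and makes the tail
    exponential rather than Gaussian. *)
Lemma bits_tail s (c : 'I_d -> R) (u t : R) :
  (forall j, `|c j| * u <= 1 / 4) -> 0 <= u ->
  \sum_v bits_weight s v *
    (t <= `|\sum_j c j * (sgn R v j - rho * sgn R s j)|)%R%:R <=
  2 * expR (8 * u ^+ 2 * \sum_j c j ^+ 2 - u * t).
Proof.
move=> cu u0; pose X v := \sum_j c j * (sgn R v j - rho * sgn R s j).
have mgf (e : bool) : \sum_v bits_weight s v * expR ((-1) ^+ e * u * X v) <=
    expR (8 * u ^+ 2 * \sum_j c j ^+ 2).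
  have yb j : `|(-1) ^+ e * u * c j| <= 1 / 4.
    by have := cu j; rewrite !normrM normrX normrN1 expr1n (ger0_norm u0); lra.
  have := mgf_bits_weight s yb; rewrite [X in 8 * X](_ : _ = u ^+ 2 * \sum_j c
    j ^+ 2).
    rewrite mulrA; apply: le_trans; apply: ler_sum => v _.
    rewrite ler_wpM2l ?(ltW (bits_weight_gt0 _ _))// /X mulr_sumr.
    by rewrite ler_expR; apply: ler_sum => j _; rewrite mulrA.
  by rewrite mulr_sumr; apply: eq_bigr => j _; rewrite !exprMn sqrr_sign mul1r.
apply: (@le_trans _ _ (\sum_v (bits_weight s v * expR ((-1) ^+ false * u * X
  v) +
    bits_weight s v * expR ((-1) ^+ true * u * X v)) * expR (- (u * t)))).
  apply: ler_sum => v _; rewrite -mulrDr -mulrA ler_wpM2l ?(ltW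
    (bits_weight_gt0 _ _))//.
  rewrite mulrDl -!expRD expr0 expr1 mul1r mulN1r -/(X v).
  have e1 := expR_ge0 (u * X v - u * t); have e2 := expR_ge0 (- u * X v - u *
    t).
  case: (leP t) => [|_]; last by rewrite addr_ge0.
  rewrite ler_normr => /orP[tX|tX].
    rewrite -[leLHS]addr0 lerD// -expR0 ler_expR -mulrBr mulr_ge0// subr_ge0//.
  rewrite -[leLHS]add0r lerD// -expR0 ler_expR mulNr -mulrN -mulrBr mulr_ge0//
    subr_ge0//.
rewrite -mulr_suml big_split/= expRD mulrA ler_wpM2r ?expR_ge0//.
have := mgf false; have := mgf true; lra.
Qed.

Definition sample_weight N s (t : N.-tuple {ffun 'I_d -> bool}) : R :=
  \prod_(i <- t) bits_weight s i.

Lemma sample_weight_gt0 N s (t : N.-tuple _) : 0 < sample_weight s t.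
Proof. by apply: prodr_gt0 => i _; exact: bits_weight_gt0. Qed.

Lemma sum_sample_weight N s : \sum_(t : N.-tuple _) sample_weight s t = 1.
Proof. by rewrite sum_tuple_prod sum_bits_weight expr1n. Qed.

(** The left side is 1 plus the divergence and factors over coordinates. Agreement contributes 1,
    disagreement [1 + 4 rho^2 / (1 - rho^2) <= 1 + 6 rho^2], as [rho^2 <= 1/4]. *)
Lemma chi2_bits s s' :
  \sum_t bits_weight s t ^+ 2 / bits_weight s' t <=
  expR (6 * rho ^+ 2 * #|[pred j | s j != s' j]|%:R).
Proof.
have /andP[r0 r1] := rho_bd.
pose F j b := bit_weight s j b ^+ 2 / bit_weight s' j b.
rewrite (_ : \sum_t _ = \prod_j \sum_b F j b); last first.
  rewrite bigA_distr_bigA; apply: eq_bigr => t _.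
  by rewrite /F big_split /= prodfV -prodrXl.
rewrite (_ : expR _ = \prod_j (if s j != s' j then expR (6 * rho ^+ 2) else
  1)); last first.
  by rewrite -big_mkcond/= prodr_const -expRM_natl [in RHS]mulrC.
apply: ler_prod => j _; apply/andP; split.
  by apply: sumr_ge0 => b _; rewrite divr_ge0 ?sqr_ge0// ltW ?bit_weight_gt0.
case: eqP => [sj|sj] /=.
  rewrite -(sum_bit_weight s j); apply: ler_sum => b _.
  rewrite /F; have -> : bit_weight s' j b = bit_weight s j b by rewrite
    /bit_weight /sgn sj.
  by rewrite expr2 mulfK// gt_eqF// bit_weight_gt0.
apply: (le_trans _ (expR_ge1Dx _)).
have s'j : s' j = ~~ s j by case: (s j) (s' j) sj => -[].
have r2 : 0 < 1 - rho ^+ 2 by nra.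
have -> : \sum_b F j b = 1 + 4 * rho ^+ 2 / (1 - rho ^+ 2).
  rewrite big_bool /F /bit_weight /sgn s'j.
  have : 1 - rho != 0 by rewrite gt_eqF//; lra.
  have : 1 + rho != 0 by rewrite gt_eqF//; lra.
  move=> h1 h2; have h3 : 1 - rho ^+ 2 != 0 by rewrite gt_eqF.
  by case: (s j); rewrite /= ?expr0 ?expr1; field; rewrite ?mulrN1 ?h1 ?h2 ?h3.
have r4 : rho ^+ 2 <= 1 / 4 by nra.
have := mulr_ge0 (sqr_ge0 rho) (_ : 0 <= 1 / 4 - rho ^+ 2); rewrite subr_ge0 =>
  /(_ r4).
have := sqr_ge0 rho; rewrite lerD2l ler_pdivrMr//; lra.
Qed.

(** The second moment of the likelihood ratio is multiplicative over draws, so the divergence is at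
    most [expR v - 1 <= v + 2 v^2 <= 2 v]. *)
Lemma chi2_sample N s s' (D : nat) v : (#|[pred j | s j != s' j]| <= D)%N ->
  6 * rho ^+ 2 * D%:R * N%:R <= v -> v <= 1 / 2 ->
  chi2 (@sample_weight N s) (sample_weight s') <= 2 * v.
Proof.
move=> sD rv v2; rewrite chi2E; last 3 first.
- by move=> t; rewrite gt_eqF// sample_weight_gt0.
- exact: sum_sample_weight.
- exact: sum_sample_weight.
have -> : \sum_(t : N.-tuple _) sample_weight s t ^+ 2 / sample_weight s' t =
    (\sum_t bits_weight s t ^+ 2 / bits_weight s' t) ^+ N.
  rewrite -sum_tuple_prod; apply: eq_bigr => t _.
  by rewrite /sample_weight big_split /= prodfV prodrXl.
have v0 : 0 <= v.
  have r2 := sqr_ge0 rho; apply: le_trans rv; do 3 (apply: mulr_ge0 => //).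
have up : (\sum_t bits_weight s t ^+ 2 / bits_weight s' t) ^+ N <= expR v.
  apply: (@le_trans _ _ (expR (6 * rho ^+ 2 * D%:R) ^+ N)).
    rewrite lerXn2r ?nnegrE ?expR_ge0//.
      by apply: sumr_ge0 => t _; rewrite divr_ge0 ?sqr_ge0// ltW//
        bits_weight_gt0.
    apply: (le_trans (chi2_bits s s')); rewrite ler_expR ler_wpM2l ?ler_nat//.
    by apply: mulr_ge0 => //; exact: sqr_ge0.
  by rewrite -expRM_natl ler_expR mulrC.
have := @expR_le_quadratic v; rewrite ger0_norm// => /(_ v2); nra.
Qed.

End bit_laws.

(** * The noise term *)

Section smooth_abs.
Context (R : realType) (delta : R).
Hypothesis delta0 : 0 < delta.
Implicit Types t : R.

Definition smooth_abs t : R := ramp delta t + ramp delta (- t).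
Definition dsmooth_abs t : R := dramp delta t - dramp delta (- t).

Lemma smooth_abs0 : smooth_abs 0 = 0.
Proof. by rewrite /smooth_abs oppr0 ramp_eq0// addr0. Qed.

Lemma smooth_abs_ge t : `|t| - delta / 2 <= smooth_abs t.
Proof.
have := ramp_ge t delta0; have := ramp_ge (- t) delta0.
have := ramp_ge0 t delta0; have := ramp_ge0 (- t) delta0; rewrite /smooth_abs.
by case: (ger0P t); lra.
Qed.

Lemma smooth_abs_ge0 t : 0 <= smooth_abs t.
Proof. by rewrite addr_ge0// ramp_ge0. Qed.

Lemma dsmooth_abs_le1 t : `|dsmooth_abs t| <= 1.
Proof.
have := dramp_ge0_le1 t delta0; have := dramp_ge0_le1 (- t) delta0.
rewrite /dsmooth_abs ler_norml => /andP[? ?] /andP[? ?]; apply/andP; split; lra.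
Qed.

Lemma smooth_abs_quadratic t t' :
  0 <= smooth_abs t' - smooth_abs t - dsmooth_abs t * (t' - t) <=
  delta^-1 * (t' - t) ^+ 2.
Proof.
have /andP[a1 a2] := ramp_quadratic t t' delta0.
have /andP[b1 b2] := ramp_quadratic (- t) (- t') delta0.
have sq : (- t' - - t) ^+ 2 = (t' - t) ^+ 2 by ring.
have h : (2 * delta)^-1 * (t' - t) ^+ 2 + (2 * delta)^-1 * (t' - t) ^+ 2 =
  delta^-1 * (t' - t) ^+ 2 by field; rewrite gt_eqF.
rewrite sq in b2; rewrite /smooth_abs /dsmooth_abs -h; apply/andP; split; lra.
Qed.

Lemma measurable_smooth_abs : measurable_fun [set: R] smooth_abs.
Proof.
apply: measurable_funD; first exact: measurable_ramp.
exact: (measurableT_comp (measurable_ramp _) (measurable_funN (@measurable_id _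
  _ _))).
Qed.

Lemma measurable_dsmooth_abs : measurable_fun [set: R] dsmooth_abs.
Proof.
apply: measurable_funB; first exact: measurable_dramp.
exact: (measurableT_comp (measurable_dramp _) (measurable_funN (@measurable_id
  _ _ _))).
Qed.

End smooth_abs.

Section hard_abs.
Context (R : realType) (d : nat) (rad l delta rho sigma : R).
Hypotheses (d_gt0 : (0 < d)%N) (rad0 : 0 < rad) (l0 : 0 < l)
  (delta0 : 0 < delta) (rho_bd : 0 < rho <= 1 / 2)
  (rho_sigma : rho * sigma = 16 * l).
Implicit Types (s v : {ffun 'I_d -> bool}) (x : 'rV[R]_d) (j : 'I_d).

Let q : R := Num.sqrt d%:R.
Let q0 : 0 < q. Proof. by rewrite sqrtr_gt0 ltr0n. Qed.
Let qq : d%:R = q ^+ 2 :> R. Proof. by rewrite sqr_sqrtr. Qed.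
Let w : R := rad / q.
Let w0 : 0 < w. Proof. by rewrite divr_gt0. Qed.
Let rho0 : 0 < rho. Proof. by have /andP[] := rho_bd. Qed.
Let sigma0 : 0 < sigma.
Proof. by rewrite -(pmulr_rgt0 _ rho0) rho_sigma mulr_gt0. Qed.

(** Equals [l / q] times the sum of the [|x_j - w s_j|], up to smoothing. As [q ^+ 2 = d], the
    gradient has norm at most [l] and the minimizer [w s] has norm [rad]. *)
Definition hard_abs s x : R :=
  l * rad / q ^+ 2 * \sum_j smooth_abs delta (x 0 j / w - sgn R s j).

Definition hard_abs_grad s x : 'rV[R]_d :=
  \row_j (l / q * dsmooth_abs delta (x 0 j / w - sgn R s j)).

Lemma hard_abs_smooth_convex s :
  smooth_convex (hard_abs s) (hard_abs_grad s) (l * rad / q ^+ 2 * (delta^-1 /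
    w ^+ 2)).
Proof.
move=> x y; pose D j := smooth_abs delta (y 0 j / w - sgn R s j) -
  smooth_abs delta (x 0 j / w - sgn R s j) -
  dsmooth_abs delta (x 0 j / w - sgn R s j) * (y 0 j / w - sgn R s j - (x 0 j /
    w - sgn R s j)).
have -> : hard_abs s y - hard_abs s x - dotp (hard_abs_grad s x) (y - x) =
    l * rad / q ^+ 2 * \sum_j D j.
  rewrite /hard_abs /dotp /D !sumrB !mulrBr; congr (_ - _ - _).
  rewrite mulr_sumr; apply: eq_bigr => j _; rewrite !mxE /w.
  by field; rewrite !gt_eqF.
have c0 : 0 < l * rad / q ^+ 2 by rewrite divr_gt0 ?mulr_gt0 ?exprn_gt0.
apply/andP; split.
  rewrite pmulr_rge0//.
  by apply: sumr_ge0 => j _; have /andP[] := smooth_abs_quadratic delta0 (x 0 j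
    / w - sgn R s j) (y 0 j / w - sgn R s j).
rewrite -[leRHS]mulrA ler_pM2l// mulr_sumr; apply: ler_sum => j _; rewrite !mxE.
have /andP[_] := smooth_abs_quadratic delta0 (x 0 j / w - sgn R s j) (y 0 j /
  w - sgn R s j).
rewrite -/(D j) => /le_trans; apply; rewrite le_eqVlt; apply/orP; left;
  apply/eqP.
by field; rewrite !gt_eqF.
Qed.

Lemma measurable_hard_abs s : measurable_fun [set: 'rV[R]_d] (hard_abs s).
Proof.
apply: measurable_funM => //; apply: measurable_sum => j.
apply: (measurableT_comp (measurable_smooth_abs _)).
apply: measurable_funB => //; apply: measurable_funM => //.
exact: measurable_coord.
Qed.

Definition hard_abs_argmin s : 'rV[R]_d := \row_j (w * sgn R s j).

Lemma hard_abs_argminE s : hard_abs s (hard_abs_argmin s) = 0.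
Proof.
rewrite /hard_abs big1 ?mulr0// => j _.
by rewrite mxE mulrAC mulfV ?gt_eqF// mul1r subrr smooth_abs0.
Qed.

Lemma hard_abs_ge0 s x : 0 <= hard_abs s x.
Proof.
apply: mulr_ge0; first by rewrite divr_ge0 ?sqr_ge0// mulr_ge0// ltW.
by apply: sumr_ge0 => j _; exact: smooth_abs_ge0.
Qed.

Lemma hard_abs_sco L s : l <= L -> sco_instance rad L (hard_abs s).
Proof.
move=> lL; have fG := hard_abs_smooth_convex s; split.
- exact: smooth_convex_differentiable fG.
- exact: smooth_convex_convex fG.
- apply: (smooth_convex_lipschitz fG) => x; apply: le_trans lL.
  rewrite -(gtr0_norm l0) -sqrtr_sqr ler_wsqrtr// /dotp.
  apply: (@le_trans _ _ (\sum_(j < d) (l / q) ^+ 2)).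
    apply: ler_sum => j _; rewrite mxE -expr2 exprMn ler_piMr ?sqr_ge0//.
    by rewrite -real_normK ?num_real// exprn_ile1// dsmooth_abs_le1.
  by rewrite sumr_const card_ord -mulr_natl qq expr_div_n mulrC divfK// gt_eqF
    ?exprn_gt0.
- exists (hard_abs_argmin s); split=> [y|]; first by rewrite hard_abs_argminE
  hard_abs_ge0.
  rewrite -(gtr0_norm rad0) -sqrtr_sqr ler_wsqrtr// /dotp.
  rewrite (eq_bigr (fun=> w ^+ 2)) => [|j _]; last by rewrite mxE mulrACA
    sgn_sqr mulr1 expr2.
  by rewrite sumr_const card_ord -mulr_natl qq expr_div_n mulrC divfK// gt_eqF
    ?exprn_gt0.
Qed.

Definition clip (t : R) : R := Num.max (-1) (Num.min 1 t).

Lemma clip_le1 t : `|clip t| <= 1.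
Proof.
rewrite /clip ler_norml; apply/andP; split; first by rewrite le_max lexx.
by rewrite ge_max ge_min lexx /= andbT; lra.
Qed.

(** Since [1 - |t - s_j| <= clip t * s_j], closeness to the signs on average gives correlation;
    smoothing costs [delta / 2] per coordinate out of [2 * delta]. Clipping bounds the scores by 1,
    as the chi-square estimates need. *)
Lemma hard_abs_optimal s eps x : eps <= l * rad * (1 - 2 * delta) ->
  eps_optimal eps (hard_abs s) x ->
  d%:R * delta <= \sum_j clip (x 0 j / w) * sgn R s j.
Proof.
move=> epsE /(eps_optimal_min0 (hard_abs_ge0 s) (hard_abs_argminE
  s))/le_trans/(_ epsE).
have lr0 : 0 < l * rad by rewrite mulr_gt0.
rewrite /hard_abs -mulrA -mulrA mulrA ler_pM2l// mulrC ler_pdivrMr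
  ?exprn_gt0// -qq.
set F := \sum_j _ => opt.
have : \sum_j (1 - smooth_abs delta (x 0 j / w - sgn R s j) - delta / 2) <=
    \sum_j clip (x 0 j / w) * sgn R s j.
  apply: ler_sum => j _; have := smooth_abs_ge delta0 (x 0 j / w - sgn R s j).
  set A := smooth_abs _ _; set t := x 0 j / w; rewrite /sgn /clip.
  case: (s j); rewrite ?expr0 ?expr1.
    have := ler_norm (t - -1); have := ler_norm (- (t - -1)); rewrite normrN.
    by rewrite /Num.max /Num.min; do 2 case: ifPn; rewrite -?leNgt; lra.
  have := ler_norm (t - 1); have := ler_norm (- (t - 1)); rewrite normrN.
  by rewrite /Num.max /Num.min; do 2 case: ifPn; rewrite -?leNgt; lra.
rewrite !sumrB !sumr_const card_ord -/F -[(delta / 2) *+ d]mulr_natl.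
apply: le_trans; move: opt delta0; have := ltr0n R d; rewrite d_gt0.
set D := d%:R; move=> D0 opt dl; have := mulr_gt0 D0 dl; lra.
Qed.

Let mid x j := (dsmooth_abs delta (x 0 j / w - 1) + dsmooth_abs delta (x 0 j /
  w + 1)) / 2.
Let gap x j := (dsmooth_abs delta (x 0 j / w - 1) - dsmooth_abs delta (x 0 j /
  w + 1)) / 2.

Let dsmooth_absE s x j :
  dsmooth_abs delta (x 0 j / w - sgn R s j) = mid x j + gap x j * sgn R s j.
Proof.
by rewrite /mid /gap /sgn; case: (s j); rewrite ?expr0 ?expr1 ?opprK; field.
Qed.

Let gap_le1 x j : `|gap x j| <= 1.
Proof.
have := dsmooth_abs_le1 delta0 (x 0 j / w - 1).
have := dsmooth_abs_le1 delta0 (x 0 j / w + 1).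
rewrite /gap !ler_norml => /andP[? ?] /andP[? ?]; apply/andP; split; lra.
Qed.

(* The [j]-th partial derivative is [mid + gap * s_j] up to a factor, and [z_j]
   has mean [rho * s_j]. *)
Definition bit_oracle x (z : 'rV[R]_d) : 'rV[R]_d :=
  \row_j (l / q * (mid x j + gap x j * (z 0 j / rho))).

Definition bit_row v : 'rV[R]_d := \row_j sgn R v j.

Definition bits_law s : probability 'rV[R]_d R :=
  fprob bit_row (fun v => ltW (bits_weight_gt0 rho_bd s v)) (sum_bits_weight
    rho s).

Lemma bits_lawE s B :
  bits_law s B = (\sum_v bits_weight rho s v * (bit_row v \in B)%:R)%:E.
Proof. exact: fprobE. Qed.

Lemma measurable_bit_oracle :
  measurable_fun [set: 'rV[R]_d * 'rV[R]_d] (fun p => bit_oracle p.1 p.2).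
Proof.
apply: measurable_fun_rVP => j.
rewrite (_ : (fun _ => _) = (fun p : 'rV[R]_d * 'rV[R]_d =>
  l / q * (mid p.1 j + gap p.1 j * (p.2 0 j / rho)))); last first.
  by apply/funext => p; rewrite mxE.
have mx : measurable_fun [set: 'rV[R]_d * 'rV[R]_d] (fun p => p.1 0 j / w).
  apply: measurable_funM => //; exact: (measurableT_comp (measurable_coord j)
    measurable_fst).
have mz : measurable_fun [set: 'rV[R]_d * 'rV[R]_d] (fun p => p.2 0 j / rho).
  apply: measurable_funM => //; exact: (measurableT_comp (measurable_coord j)
    measurable_snd).
have md1 : measurable_fun [set: 'rV[R]_d * 'rV[R]_d] (fun p => dsmooth_abs
  delta (p.1 0 j / w - 1)).
  apply: (measurableT_comp (measurable_dsmooth_abs delta)); exact: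
    measurable_funB.
have md2 : measurable_fun [set: 'rV[R]_d * 'rV[R]_d] (fun p => dsmooth_abs
  delta (p.1 0 j / w + 1)).
  apply: (measurableT_comp (measurable_dsmooth_abs delta)); exact:
    measurable_funD.
apply: measurable_funM => //; apply: measurable_funD; first by apply:
  measurable_funM => //; exact: measurable_funD.
by apply: measurable_funM => //; apply: measurable_funM => //; exact:
  measurable_funB.
Qed.

Lemma bit_oracle_esgo s : is_esgo sigma (hard_abs s) (bits_law s) bit_oracle.
Proof.
have fs : finitely_supported (bits_weight rho s) bit_row (bits_law s).
  exact: finitely_supported_fprob.
have ws0 v : 0 <= bits_weight rho s v by exact: ltW (bits_weight_gt0 rho_bd s
  v).
split; first split; first exact: measurable_bit_oracle.
- move=> x j; have mO : measurable_fun [set: 'rV[R]_d] (fun z => bit_oracle x z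
  0 j).
    apply: (measurableT_comp (measurable_coord j)).
    exact: (measurableT_comp measurable_bit_oracle (measurable_fun_pair
      (measurable_cst x) (@measurable_id _ _ _))).
  split; first exact: (integrable_finitely_supported ws0 fs mO).
  rewrite unlock (integral_finitely_supported ws0 fs mO).
  rewrite (smooth_convex_grad (hard_abs_smooth_convex s)) mxE dsmooth_absE;
    congr EFin.
  under eq_bigr do rewrite !mxE.
  transitivity (l / q * (mid x j * (\sum_v bits_weight rho s v) +
    gap x j / rho * (\sum_v bits_weight rho s v * sgn R v j))).
    by rewrite !mulr_sumr -big_split/= mulr_sumr; apply: eq_bigr => v _; ring.
  by rewrite sum_bits_weight mean_bits_weight; field; rewrite !gt_eqF.
move=> x u t u1 t0; rewrite (smooth_convex_grad (hard_abs_smooth_convex s)).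
pose c j := u 0 j * (l / q * (gap x j / rho)).
(* As [rho * sigma = 16 * l], this Chernoff parameter gives [|c j| * la <= |u_j| / 8], hence an
   exponent of at most [1/8 - 2 * tau]. *)
pose la := 2 * q / sigma; have la0 : 0 < la by rewrite divr_gt0 ?mulr_gt0.
have cE : l / q / rho * la = 8^-1.
  by rewrite /la -[l](mulKf (_ : 16 != 0)) ?gt_eqF// -rho_sigma; field; rewrite
    !gt_eqF.
have c_le j : `|c j| * la <= `|u 0 j| * 8^-1.
  have lqr : 0 < l / q / rho by rewrite !divr_gt0.
  rewrite -cE [leRHS]mulrA ler_wpM2r ?(ltW la0)// /c normrM ler_wpM2l//.
  rewrite (_ : l / q * (gap x j / rho) = l / q / rho * gap x j); last first.
    by field; rewrite !gt_eqF.
  by rewrite normrM (gtr0_norm lqr) ler_piMr ?gap_le1 ?ltW.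
have u_le j : `|u 0 j| <= 1 by rewrite -u1 coord_le_enorm.
rewrite bits_lawE lee_fin.
apply: (@le_trans _ _ (\sum_v bits_weight rho s v *
    (t <= `|\sum_j c j * (sgn R v j - rho * sgn R s j)|)%R%:R)).
  apply: ler_sum => v _; rewrite ler_wpM2l//.
  rewrite (_ : \sum_j _ = dotp (bit_oracle x (bit_row v) - hard_abs_grad s x)
    u).
    rewrite ler_nat; have [_|tX] := boolP (t <= _); first exact: leq_b1.
    by rewrite memNset//=; exact/negP.
  apply: eq_bigr => j _; rewrite !mxE dsmooth_absE /c.
  by field; rewrite !gt_eqF.
set tau := t * Num.sqrt d%:R / sigma.
(* For [tau <= 1/8] the claimed bound is at least 1; otherwise [1/8 - 2 * tau <= - tau]. *)
have [tau8|tau8] := leP tau 8^-1.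
  apply: (@le_trans _ _ 1).
    rewrite -[leRHS](sum_bits_weight rho s); apply: ler_sum => v _.
    by rewrite ler_piMr// lern1 leq_b1.
  by have := expR_ge1Dx (- tau); lra.
apply: (le_trans (@bits_tail _ _ _ rho_bd s c la t _ (ltW la0))).
  by move=> j; apply: (le_trans (c_le j)); have := u_le j; lra.
rewrite ler_wpM2l// ler_expR.
have -> : la * t = 2 * tau by rewrite /la /tau -/q; ring.
have : la ^+ 2 * \sum_j c j ^+ 2 <= 64^-1.
  rewrite mulr_sumr (_ : 64^-1 = dotp u u * (8^-1 * 8^-1)); last first.
    by rewrite -sqr_enorm u1; field.
  rewrite /dotp mulr_suml; apply: ler_sum => j _.
  rewrite -exprMn -real_normK ?num_real// normrM (gtr0_norm la0) mulrC.
  rewrite (_ : u 0 j * u 0 j * _ = (`|u 0 j| * 8^-1) ^+ 2); last first.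
    by rewrite exprMn real_normK ?num_real//; ring.
  by apply: lerXn2r (c_le j); rewrite nnegrE mulr_ge0 // ltW.
lra.
Qed.

End hard_abs.

(** * The lower bound *)

Lemma solves_information (R : realType) (d : nat)
    (rad L sigma eps l delta rho : R) (dS : measure_display)
    (S : measurableType dS) (P : probability S R) (A : algorithm R d S) (N :
      nat) :
  solves rad L sigma eps P A N -> (0 < d)%N -> 0 < rad -> 0 < l <= L ->
  0 < delta <= 1 / 4 -> 0 < rho <= 1 / 2 -> rho * sigma = 16 * l ->
  eps <= l * rad * (1 - 2 * delta) ->
  delta ^+ 4 / (720 * rho ^+ 2) <= N%:R.
Proof.
move=> Asolves d0 rad0 /andP[l0 lL] /andP[delta0 delta4] rho_bd rhoE epsE.
pose cube := {ffun 'I_d -> bool}.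
(* For a fixed seed the run is a function of the sampled bits, the same one for every instance; [y]
   is its output, rescaled and clipped. *)
have avg (J : finType) (th : J -> cube) (C : R) :
    (forall y : 'I_d -> N.-tuple cube -> R, (forall i t, `|y i t| <= 1) ->
      \sum_j \sum_t sample_weight rho (th j) t *
        (d%:R * delta <= \sum_i y i t * sgn R (th j) i)%R%:R <= C) ->
    2 / 3 * #|J|%:R <= C.
  move=> bound; apply: (solves_average Asolves
    (fun j => hard_abs_sco d0 rad0 l0 delta0 (th j) lL)
    (fun j => measurable_hard_abs rad l delta (th j))
    (fun j => bit_oracle_esgo d0 rad0 l0 delta0 rho_bd rhoE (th j))
    (fun j v => ltW (bits_weight_gt0 rho_bd (th j) v))
    (fun j => finitely_supported_fprob _ _ _)) => s.
  pose y (i : 'I_d) (t : N.-tuple cube) := clip (run A (bit_oracle rad l delta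
    rho) s
    (map (@bit_row R d) t) 0 i / (rad / Num.sqrt d%:R)).
  apply: le_trans (bound y _); last by move=> i t; exact: clip_le1.
  apply: ler_sum => j _; apply: ler_sum => t _.
  rewrite ler_wpM2l ?(ltW (sample_weight_gt0 rho_bd _ _))//.
  case: asboolP => // /(hard_abs_optimal d0 rad0 l0 delta0 epsE).
  by rewrite /y => ->.
have rho0 : 0 < rho by case/andP: rho_bd.
have den0 : 0 < 720 * rho ^+ 2 by apply: mulr_gt0; [lra|exact: exprn_gt0].
rewrite leNgt ltr_pdivlMr//; apply/negP => small.
have dlt0 : 0 < d%:R * delta by rewrite mulr_gt0 ?ltr0n.
have weights_gt0 s (t : N.-tuple cube) : 0 < sample_weight rho s t.
  exact: sample_weight_gt0.
have weights_sum s : \sum_(t : N.-tuple cube) sample_weight rho s t = 1.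
  exact: sum_sample_weight.
have delta4_le : delta ^+ 4 <= delta ^+ 2.
  by rewrite ler_wiXn2l ?(ltW delta0)//; lra.
have delta4_ge0 : 0 <= delta ^+ 4 by rewrite exprn_ge0// ltW.
have delta2_le : delta ^+ 2 <= 1 / 16.
  have -> : 1 / 16 = (1 / 4) ^+ 2 :> R by field.
  by apply: lerXn2r delta4; rewrite nnegrE; lra.
have [d_large|d_small] := leP 6 (d%:R * delta ^+ 2).
  (* Large dimension: with [X = delta^4 / 4] this [a] balances the two terms of [assouad]. Markov's
     inequality for the squared score then bounds the success by [1/6 + 1/4 < 2/3]. *)
  pose a := 2 / delta ^+ 2; have a0 : 0 < a by rewrite divr_gt0// exprn_gt0.
  have chi s i : chi2 (@sample_weight R d rho N s) (sample_weight rho (flip i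
    s)) <= 2 * (delta ^+ 4 / 8).
    apply: (@chi2_sample _ _ _ rho_bd _ _ _ 1); [|lra|lra].
    apply: leq_trans (_ : #|pred1 i| <= 1)%N; last by rewrite card1.
    apply/subset_leq_card/fintype.subsetP => j; rewrite !inE ffunE.
    by have [//|_] := eqVneq j i; rewrite addFb eqxx.
  have : 2 / 3 * #|{: cube}|%:R <= (2 ^ d)%:R * (d%:R + d%:R ^+ 2 *
      ((a * (2 * (delta ^+ 4 / 8)) + a^-1) / 4)) / (d%:R * delta) ^+ 2.
    apply: (avg _ id) => y y1; rewrite ler_pdivlMr ?exprn_gt0// mulr_suml.
    apply: le_trans (assouad d0 weights_gt0 weights_sum chi y1 a0).
    apply: ler_sum => s _; rewrite mulr_suml; apply: ler_sum => t _.
    rewrite -mulrA ler_wpM2l ?(ltW (weights_gt0 _ _))//.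
    case: (leP (d%:R * delta)) => h; rewrite ?mul0r ?sqr_ge0// mul1r.
    by rewrite lerXn2r ?nnegrE ?(ltW dlt0)// (le_trans (ltW dlt0)).
  rewrite (_ : _ / _ ^+ 2 = (2 ^ d)%:R * ((d%:R * delta ^+ 2)^-1 + 1 / 4));
    last first.
    by rewrite /a; field; rewrite !gt_eqF ?ltr0n.
  rewrite card_ffun card_bool card_ord mulrC ler_pM2l ?ltr0n ?expn_gt0//.
  have : (d%:R * delta ^+ 2)^-1 <= 6^-1 by rewrite lef_pV2 ?posrE// mulr_gt0
    ?ltr0n ?exprn_gt0.
  lra.
(* Small dimension: the two constant sign vectors differ in all [d] coordinates, but
   [d * delta^4 <= 6 * delta^2] keeps the divergence at most [1/10]. With [a = 3] the two success
   probabilities sum to at most [79/60 < 4/3]. *)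
suff : 2 / 3 * #|{: bool}|%:R <= 1 + 3 / 2 * (2 * (1 / 20)) + 1 / (2 * 3) :> R.
  by rewrite card_bool; lra.
apply: (avg _ (fun b => [ffun=> b])) => y y1; rewrite big_bool.
set E := fun t : N.-tuple cube => d%:R * delta <= \sum_i y i t * sgn R [ffun=>
  true] i.
set F := fun t : N.-tuple cube => d%:R * delta <= \sum_i y i t * sgn R [ffun=>
  false] i.
have EF t : E t -> F t -> False.
  rewrite /E /F; have -> : \sum_i y i t * sgn R [ffun=> true] i = - \sum_i y i
    t * sgn R [ffun=> false] i.
    by rewrite -sumrN; apply: eq_bigr => i _; rewrite /sgn !ffunE expr0 expr1;
      ring.
  lra.
have three0 : 0 < 3 :> R by [].
apply: (le_trans (two_point_bound (sample_weight rho [ffun=> true])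
  (weights_gt0 [ffun=> false])
  (weights_sum [ffun=> false]) three0 EF)).
rewrite lerD2r lerD2l; apply: ler_wpM2l; first lra.
apply: (@chi2_sample _ _ _ rho_bd _ _ _ d); [| |lra].
  by rewrite -[X in (_ <= X)%N]card_ord max_card.
have : d%:R * (720 * rho ^+ 2 * N%:R) <= d%:R * delta ^+ 4 by rewrite
  ler_wpM2l// ltW// mulrC.
have : d%:R * delta ^+ 4 <= 6 * delta ^+ 2.
  by rewrite (_ : d%:R * _ = d%:R * delta ^+ 2 * delta ^+ 2) ?ler_wpM2r
    ?sqr_ge0 ?(ltW d_small)//; ring.
lra.
Qed.

Lemma ln2_bounds (R : realType) : 1 / 2 <= ln (2 : R) <= 1.
Proof.
apply/andP; split.
  rewrite -ler_expR lnK ?posrE//.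
  have := @expR_le_quadratic R (1 / 2); rewrite ger0_norm// => /(_ (lexx _));
    lra.
have := @le_ln1Dx R 1; rewrite (_ : 1 + 1 = 2)//; apply; lra.
Qed.

(** [B] may be any upper bound of [T], so that the logarithm can be that of the sum of both
    terms. *)
Lemma solves_dimension (R : realType) (d : nat) (rad L sigma eps B : R)
    (dS : measure_display) (S : measurableType dS) (P : probability S R)
    (A : algorithm R d S) (N : nat) :
  let T := Num.min (rad ^+ 2 * L ^+ 2 / eps ^+ 2) d%:R in
  solves rad L sigma eps P A N -> (0 < d)%N -> 0 < rad -> 0 < L -> 0 < eps ->
  (0 < N)%N -> T <= B -> T <= 32 * (N%:R * (1 + ln (1 + B))).
Proof.
move=> T Asolves d0 rad0 L0 eps0 N0 TB.
(* The factor [1/4] fits [r = 2 * eps / L] below: [m <= x] gives [m * r^2 <= rad^2]. *)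
pose x := rad ^+ 2 * L ^+ 2 / eps ^+ 2 / 4.
have xE : rad ^+ 2 * L ^+ 2 / eps ^+ 2 = 4 * x by rewrite /x [RHS]mulrC divfK.
have Tx : T <= 4 * x by rewrite /T ge_min xE lexx.
have Td : T <= d%:R by rewrite /T ge_min lexx orbT.
have x0 : 0 <= x by rewrite ltW// !divr_gt0 ?mulr_gt0 ?exprn_gt0.
have T0 : 0 <= T by rewrite /T le_min ler0n xE mulr_ge0.
have N1 : 1 <= N%:R :> R by rewrite ler1n.
have lnB : 0 <= ln (1 + B) by rewrite ln_ge0// lerDl (le_trans T0).
have NlnB : 1 <= N%:R * (1 + ln (1 + B)) by rewrite mulr_ege1//; lra.
have [x1|x1] := ltP x 1; first lra.
pose m := minn d (Num.truncn x).
have tx1 : 1 <= (Num.truncn x)%:R :> R by rewrite ler1n truncn_gt0.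
have tx : x <= 2 * (Num.truncn x)%:R.
  by have := truncnS_gt x; rewrite -natr1; lra.
have txx : (Num.truncn x)%:R <= x by rewrite truncn_le.
have m0 : (0 < m)%N by rewrite leq_min d0 truncn_gt0.
have mT : m%:R <= T.
  rewrite le_min; apply/andP; split; last by rewrite ler_nat geq_minl.
  rewrite xE.
  by apply: (@le_trans _ _ (Num.truncn x)%:R); [rewrite ler_nat geq_minr|lra].
have Tm : T <= 8 * m%:R.
  by rewrite /m; case: leqP => _; have := ler0n R d; lra.
have mx : m%:R <= x by apply: le_trans txx; rewrite ler_nat geq_minr.
have := solves_counting (m := m) (r := 2 * eps / L) Asolves (ltW rad0) L0.
rewrite m0 geq_minl => /(_ isT) counting.
have {}counting : (7 * 2 ^ m <= 12 * (m * 2).+1 ^ N)%N.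
  apply: counting; last by rewrite ltr_pM2r ?invr_gt0//; lra.
  apply: (le_trans (ler_wpM2r (sqr_ge0 _) mx)).
  by rewrite le_eqVlt; apply/orP; left; apply/eqP; rewrite /x; field; rewrite
    !gt_eqF.
(* The constant [12/7 <= 2] goes into the base because [N > 0], and [4 m + 2 <= 4 (1 + B)]. *)
have {}counting : 2 ^+ m <= (4 * (1 + B)) ^+ N :> R.
  apply: (@le_trans _ _ ((2 * (m * 2).+1)%N%:R ^+ N)).
    rewrite -[leLHS]natrX -[leRHS]natrX ler_nat expnMn.
    apply: (@leq_trans (2 * (m * 2).+1 ^ N)).
      by move: counting; clear; move: (2 ^ m)%N (_ ^ N)%N => a b; lia.
    by rewrite leq_mul2r; apply/orP; right; rewrite -[leqLHS]expn1 leq_pexp2l.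
  have mB := le_trans mT TB.
  apply: lerXn2r; rewrite ?nnegrE//; first by have := ler0n R m; lra.
  have -> : (2 * (m * 2).+1 = m * 4 + 2)%N by rewrite mulnS addnC mulnCA.
  by rewrite natrD natrM; lra.
have /andP[ln2_ge ln2_le] := ln2_bounds R.
have B0 : 0 < 1 + B by have := le_trans T0 TB; lra.
have : m%:R * ln 2 <= N%:R * (ln 2 + ln 2 + ln (1 + B)).
  have -> : ln 2 + ln 2 + ln (1 + B) = ln (4 * (1 + B)).
    by rewrite -!lnM ?posrE ?mulr_gt0//; congr (ln (_ * _)); ring.
  by rewrite [leLHS]mulr_natl [leRHS]mulr_natl -!lnXn ?mulr_gt0// ler_ln ?posrE
    ?exprn_gt0 ?mulr_gt0.
have : N%:R * (ln 2 + ln 2 + ln (1 + B)) <= N%:R * (2 * (1 + ln (1 + B))).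
  by rewrite ler_wpM2l//; lra.
have : m%:R * (1 / 2) <= m%:R * ln (2 : R) by apply: ler_wpM2l.
lra.
Qed.

(** For [eps >= L * rad] the origin is [eps]-optimal without any query, whence the cap on [eps]. The
    constants depend on [kappa] alone, and the power of the logarithm is the factor hidden by the
    tilde. *)
Theorem theorem5 (R : realType) (kappa : R) (kappa_lt1 : kappa < 1) :
  exists (c : R) (k : nat), 0 < c /\
  forall (d : nat) (rad L sigma eps : R),
    (0 < d)%N -> 0 < rad -> 0 < L -> 0 < sigma -> 0 < eps ->
    eps <= kappa * (L * rad) ->
  forall (dS : measure_display) (S : measurableType dS) (P : probability S R)
    (A : algorithm R d S) (N : nat),
    solves rad L sigma eps P A N ->
    let B := rad ^+ 2 * sigma ^+ 2 / eps ^+ 2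
             + Num.min (rad ^+ 2 * L ^+ 2 / eps ^+ 2) d%:R in
    c * B / (1 + ln (1 + B)) ^+ k <= N%:R.
Proof.
(* [1 - 2 * delta = k1], so that [l = eps / (rad * k1)] meets the accuracy condition with equality;
   [k1 >= 1/2] ensures [delta <= 1/4]. *)
pose k1 := Num.max kappa (1 / 2); pose delta := (1 - k1) / 2.
have k1_lt1 : k1 < 1 by rewrite /k1 gt_max kappa_lt1; lra.
have k1_half : 1 / 2 <= k1 by rewrite /k1 le_max lexx orbT.
have kappa_k1 : kappa <= k1 by rewrite /k1 le_max lexx.
have delta0 : 0 < delta by rewrite /delta; lra.
have delta4 : delta <= 1 / 4 by rewrite /delta; lra.
pose c1 := delta ^+ 4 * k1 ^+ 2 / (720 * 256).
have k10 : 0 < k1 by lra.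
have c10 : 0 < c1 by apply: divr_gt0; [rewrite mulr_gt0 ?exprn_gt0|lra].
have c1_le : c1 * 4096 <= 1.
  have : delta ^+ 4 * k1 ^+ 2 <= 1.
    by rewrite mulr_ile1 ?exprn_ge0 ?exprn_ile1 ?ltW//; lra.
  by rewrite /c1; lra.
(* Adding [c1 * T1 <= N] and [c1 * T2 <= 32 * c1 * N * (1 + ln (1 + B))] gives this constant and one
   logarithm. *)
exists (c1 / (1 + 32 * c1)), 1%N; split; first by rewrite divr_gt0//; lra.
move=> d rad L sigma eps d0 rad0 L0 sigma0 eps0 epsk dS S P A N Asolves; cbv
  zeta.
set T1 := rad ^+ 2 * sigma ^+ 2 / eps ^+ 2; set T2 := Num.min _ _.
set B := T1 + T2.
have Lr0 : 0 < L * rad by rewrite mulr_gt0.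
have eps_lt : eps < L * rad.
  by apply: (le_lt_trans epsk); rewrite gtr_pMl.
(* With [m = 1] and no query the counting bound would read [14 <= 12]. *)
have N_gt0 : (0 < N)%N.
  have := solves_counting (m := 1) (r := rad) Asolves (ltW rad0) L0.
  rewrite d0 mul1r ltr_pdivrMr// mulrC lexx eps_lt => /(_ isT isT isT).
  by case: N {Asolves}.
have N1 : 1 <= N%:R :> R by rewrite ler1n.
have T10 : 0 <= T1 by rewrite ltW// divr_gt0 ?mulr_gt0 ?exprn_gt0.
have bound1 : c1 * T1 <= N%:R.
  pose l := eps / (rad * k1); pose rho := 16 * l / sigma.
  have l0 : 0 < l by rewrite divr_gt0// mulr_gt0.
  have rho0 : 0 < rho by rewrite divr_gt0// mulr_gt0.
  have c1T1 : c1 * T1 = delta ^+ 4 / (720 * rho ^+ 2).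
    by rewrite /c1 /T1 /rho /l; field; rewrite !gt_eqF.
  have [rho2|rho2] := leP rho (1 / 2).
    rewrite c1T1; apply: (solves_information (l := l) Asolves d0 rad0); rewrite
      ?rho0 ?delta0 ?l0//=.
    - rewrite /l ler_pdivrMr ?mulr_gt0//; apply: (le_trans epsk).
      have -> : L * (rad * k1) = k1 * (L * rad) by ring.
      by rewrite ler_pM2r.
    - by rewrite /rho; field; rewrite gt_eqF.
    - by rewrite /l /delta (_ : _ * _ = eps)//; field; rewrite !gt_eqF.
  (* For [rho > 1/2] the noise term is bounded: [T1 = 256 / (rho * k1)^2 <= 4096], so one query
     already pays for it. *)
  apply: le_trans N1; apply: le_trans c1_le; rewrite ler_wpM2l ?(ltW c10)//.
  have : T1 * rho ^+ 2 * k1 ^+ 2 = 256.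
    by rewrite /T1 /rho /l; field; rewrite !gt_eqF.
  have : 1 / 16 <= rho ^+ 2 * k1 ^+ 2.
    have h4 : 1 / 4 <= rho * k1.
      have -> : 1 / 4 = 1 / 2 * (1 / 2) :> R by field.
      by apply: ler_pM => //; rewrite ?ltW//; lra.
    have -> : 1 / 16 = (1 / 4) ^+ 2 :> R by field.
    by rewrite -exprMn; apply: lerXn2r h4; rewrite nnegrE; [lra|rewrite
      mulr_ge0 ?ltW].
  move=> h1 h2; have := ler_wpM2l T10 h1; lra.
have T20 : 0 <= T2 by rewrite /T2 le_min ler0n andbT ltW// divr_gt0 ?mulr_gt0
  ?exprn_gt0.
have lnB : 0 <= ln (1 + B) by rewrite ln_ge0// lerDl /B addr_ge0.
have bound2 : T2 <= 32 * (N%:R * (1 + ln (1 + B))).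
  by apply: (solves_dimension Asolves) => //; rewrite /B lerDr.
rewrite expr1 ler_pdivrMr; last lra.
rewrite mulrAC ler_pdivrMr; last lra.
have : c1 * T2 <= c1 * (32 * (N%:R * (1 + ln (1 + B)))) by rewrite ler_wpM2l//
  ltW.
have : N%:R <= N%:R * (1 + ln (1 + B)) by rewrite ler_peMr//; lra.
rewrite /B; lra.
Qed.
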